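(* For every 3-hypergraph $\mathbb{H}$, the 3-hypergraph semiring $S_{\mathbb{H}}$ is nonfinitely based and subdirectly irreducible.
   Context: A hypergraph $\mathbb{H}=(V,E)$ consists of a finite set $V$ of vertices and a set $E$ of subsets of $V$ (hyperedges). A 3-hypergraph is a hypergraph whose largest hyperedge has exactly 3 elements and which satisfies the following standing assumptions: it is finite; it is linear (any two distinct hyperedges share at most one vertex); every vertex lies in some hyperedge; every hyperedge has at least 2 elements; and every hyperedge with exactly 2 elements is disjoint from all other hyperedges. A subhyperedge is a nonempty subset of a hyperedge. Two subhyperedges $e_1',e_2'$ are linked if there is a single vertex $w\notin e_1'\cup e_2'$ such that $e_1'\cup\{w\}$ and $e_2'\cup\{w\}$ are both hyperedges. The 3-hypergraph semigroup $SG_{\mathbb{H}}$ is the semigroup given by the presentation with generators $\mathbf{a}_u$ ($u\in V$) and $0$, and relations: $\mathbf{a}_u\mathbf{a}_v=\mathbf{a}_v\mathbf{a}_u$; $0\mathbf{a}_u=\mathbf{a}_u0=00=0$; $\mathbf{a}_u\mathbf{a}_v=0$ if $u=v$ or $\{u,v\}$ is not a subhyperedge; $\mathbf{a}_u\mathbf{a}_v\mathbf{a}_h=0$ if $\{u,v,h\}\notin E$; $\mathbf{a}_{u_i}\mathbf{a}_{u_j}=\mathbf{a}_{u_r}\mathbf{a}_{u_l}$ if $\{u_i,u_j\}$ and $\{u_r,u_l\}$ are linked; and for every hyperedge $\{u_1,\dots,u_k\}$ (of $k$ elements), $\mathbf{a}_{u_1}\cdots\mathbf{a}_{u_k}=\mathbf{a}$,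 where $\mathbf{a}$ is one and the same (nonzero) element for all hyperedges. This semigroup with zero is 0-cancellative ($xy=xz\neq0\Rightarrow y=z$ and dually), and therefore becomes a semiring $S_{\mathbb{H}}$, called the 3-hypergraph semiring of $\mathbb{H}$, under the flat addition $x+x=x$ and $x+y=0$ for $x\ne y$. A semiring is an algebra $(S,+,\cdot)$ with both operations associative, $+$ commutative, and $\cdot$ distributing over $+$ on both sides; the signature is $\{+,\cdot\}$ only. A semiring $S$ is nonfinitely based if the variety $\mathbf{V}(S)$ it generates cannot be defined by finitely many identities. *)

(* Defs.v *)
From mathcomp Require Import all_boot.
From mathcomp Require Import boolp.
From Stdlib Require List.

Set Implicit Arguments.
Unset Strict Implicit.
Unset Printing Implicit Defensive.

Record algebra := Algebra {
  carrier :> Type;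
  add : carrier -> carrier -> carrier;
  mul : carrier -> carrier -> carrier
}.

Arguments add {a}.
Arguments mul {a}.

Definition is_semiring (A : algebra) : Prop :=
  [/\ associative (@add A), commutative (@add A), associative (@mul A),
      left_distributive (@mul A) (@add A) &
      right_distributive (@mul A) (@add A)].

Record semiring := Semiring {
  semiring_algebra :> algebra;
  semiringP : is_semiring semiring_algebra
}.

Definition homomorphism (A B : algebra) (f : A -> B) : Prop :=
  {morph f : x y / add x y >-> add x y} /\
  {morph f : x y / mul x y >-> mul x y}.

Definition surjective (A B : Type) (f : A -> B) : Prop :=
  forall y, exists x, f x = y.

Definition isomorphism (A B : algebra) (f : A -> B) : Prop :=
  homomorphism f /\ bijective f.

Definition product (I : Type) (A : I -> algebra) : algebra :=
  @Algebra (forall i, A i) (fun f g i => add (f i) (g i))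
                           (fun f g i => mul (f i) (g i)).

(* A subalgebra of B is given, up to isomorphism, by an embedding into B. *)
Definition variety (K : algebra -> Prop) : Prop :=
  [/\ forall (A B : algebra) (f : A -> B),
        homomorphism f -> injective f -> K B -> K A,
      forall (A B : algebra) (f : A -> B),
        homomorphism f -> surjective f -> K A -> K B &
      forall (I : Type) (A : I -> algebra),
        (forall i, K (A i)) -> K (product A)].

Definition generated_variety (S A : algebra) : Prop :=
  forall K : algebra -> Prop, variety K -> K S -> K A.

Inductive term : Type :=
| Var of nat
| Add of term & term
| Mul of term & term.

Fixpoint eval (A : algebra) (rho : nat -> A) (t : term) : A :=
  match t with
  | Var n => rho n
  | Add t1 t2 => add (eval rho t1) (eval rho t2)
  | Mul t1 t2 => mul (eval rho t1) (eval rho t2)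
  end.

Definition identity : Type := (term * term)%type.

Definition satisfies (A : algebra) (e : identity) : Prop :=
  forall rho : nat -> A, eval rho e.1 = eval rho e.2.

Definition finitely_based (S : algebra) : Prop :=
  exists Sigma : seq identity, forall A : algebra,
    generated_variety S A <-> List.Forall (satisfies A) Sigma.

Definition nonfinitely_based (S : algebra) : Prop := ~ finitely_based S.

Definition subdirect_embedding (A : algebra) (I : Type) (B : I -> algebra)
    (f : A -> product B) : Prop :=
  [/\ homomorphism f, injective f & forall i, surjective (fun x => f x i)].

(* As the index type may be empty, one-element algebras are excluded. *)
Definition subdirectly_irreducible (A : algebra) : Prop :=
  forall (I : Type) (B : I -> algebra) (f : A -> product B),
    subdirect_embedding f -> exists i, isomorphism (fun x => f x i).

Record hypergraph := Hypergraph {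
  vertex : finType;
  hyperedges : {set {set vertex}}
}.

Definition linear (H : hypergraph) : Prop :=
  forall e f : {set vertex H}, e \in hyperedges H -> f \in hyperedges H ->
    e != f -> #|e :&: f| <= 1.

Definition is_hypergraph3 (H : hypergraph) : Prop :=
  [/\ \max_(e in hyperedges H) #|e| = 3,
      linear H,
      cover (hyperedges H) = [set: vertex H],
      forall e : {set vertex H}, e \in hyperedges H -> 2 <= #|e| &
      forall e f : {set vertex H}, e \in hyperedges H -> f \in hyperedges H ->
        #|e| = 2 -> f != e -> [disjoint e & f]].

Record hypergraph3 := Hypergraph3 {
  hypergraph3_hypergraph :> hypergraph;
  hypergraph3P : is_hypergraph3 hypergraph3_hypergraph
}.

Definition subhyperedge (H : hypergraph) (e' : {set vertex H}) : bool :=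
  (e' != set0) && [exists e in hyperedges H, e' \subset e].

Definition linked (H : hypergraph) (e1 e2 : {set vertex H}) : bool :=
  [&& subhyperedge e1, subhyperedge e2 &
   [exists w, [&& w \notin e1 :|: e2, w |: e1 \in hyperedges H &
                  w |: e2 \in hyperedges H]]].

Section Semigroup.
Variable H : hypergraph.
Local Notation V := (vertex H).
Local Notation E := (hyperedges H).

(* [Some u] is the generator a_u and [None] is the generator 0. *)
Local Notation generator := (option V).

(* In the last rule, uniq s says that s enumerates the hyperedge [set:: s]
   without repetition. *)
Inductive sg_relation : seq generator -> seq generator -> Prop :=
| sg_comm (u v : V) :
    sg_relation [:: Some u; Some v] [:: Some v; Some u]
| sg_zerol (u : V) : sg_relation [:: None; Some u] [:: None]
| sg_zeror (u : V) : sg_relation [:: Some u; None] [:: None]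
| sg_zero2 : sg_relation [:: None; None] [:: None]
| sg_pair (u v : V) :
    (u == v) || ~~ subhyperedge [set u; v] ->
    sg_relation [:: Some u; Some v] [:: None]
| sg_triple (u v h : V) :
    [set u; v; h] \notin E ->
    sg_relation [:: Some u; Some v; Some h] [:: None]
| sg_linked (ui uj ur ul : V) :
    linked [set ui; uj] [set ur; ul] ->
    sg_relation [:: Some ui; Some uj] [:: Some ur; Some ul]
| sg_edge (s t : seq V) :
    uniq s -> [set:: s] \in E -> uniq t -> [set:: t] \in E ->
    sg_relation (map Some s) (map Some t).

Inductive sg_congr : seq generator -> seq generator -> Prop :=
| sg_congr_rel p s t q :
    sg_relation s t -> sg_congr (p ++ s ++ q) (p ++ t ++ q)
| sg_congr_refl s : sg_congr s s
| sg_congr_sym s t : sg_congr s t -> sg_congr t s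
| sg_congr_trans s t r : sg_congr s t -> sg_congr t r -> sg_congr s r.

(* The free semigroup on the generators consists of the nonempty words. *)
Local Notation word := {s : seq generator | s != [::]}.

Lemma word_cat_proof (x y : word) : val x ++ val y != [::].
Proof. by case: x => [[|g s]]. Qed.

Definition word_cat (x y : word) : word := Sub (val x ++ val y) (word_cat_proof x y).

Definition word_zero : word := Sub [:: None] isT.

Definition word_congr : rel word := fun x y => `[< sg_congr (val x) (val y) >].

Lemma word_congr_refl : reflexive word_congr.
Proof. by move=> x; apply/asboolP/sg_congr_refl. Qed.

Lemma word_congr_sym : symmetric word_congr.
Proof. by move=> x y; apply/asboolP/asboolP; apply: sg_congr_sym. Qed.

Lemma word_congr_trans : transitive word_congr.
Proof.
move=> y x z /asboolP xy /asboolP yz.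
exact/asboolP/(sg_congr_trans xy yz).
Qed.

Canonical word_congr_equiv :=
  EquivRel word_congr word_congr_refl word_congr_sym word_congr_trans.

Local Notation semigroup := {eq_quot word_congr_equiv}%qT.

Definition sg_mul : semigroup -> semigroup -> semigroup :=
  lift_op2 semigroup word_cat.

Definition sg_zero : semigroup := (\pi word_zero)%qT.

Definition flat_add (x y : semigroup) : semigroup :=
  if x == y then x else sg_zero.

Definition flat_algebra : algebra := Algebra flat_add sg_mul.

End Semigroup.

Notation hypergraph_semigroup H := {eq_quot (word_congr_equiv H)}%qT.

(* Distributivity in the flat extension amounts to 0-cancellativity of the
   semigroup, which is proved below through normal forms of words. *)

Section NormalForms.
Variable H : hypergraph.
Local Notation V := (vertex H).
Local Notation E := (hyperedges H).
Local Notation generator := (option V).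
Local Notation word := {s : seq generator | s != [::]}.
Local Notation semigroup := (hypergraph_semigroup H).
Hypothesis H3 : is_hypergraph3 H.

(* [NPair w] stands for the common value of the products a_u a_v such that
   {u, v, w} is a hyperedge, and [NOne] for the empty word. *)
Inductive normal_form : Type :=
| NOne | NZero | NTop | NGen of V | NPair of V.

Definition nf_mul (x y : normal_form) : normal_form :=
  match x, y with
  | NOne, z | z, NOne => z
  | NGen u, NGen v =>
      if u == v then NZero
      else if [set u; v] \in E then NTop
      else if [pick w | (w \notin [set u; v]) && (w |: [set u; v] \in E)]
             is Some w then NPair w
      else NZero
  | NGen u, NPair w | NPair w, NGen u => if u == w then NTop else NZero
  | _, _ => NZero
  end.

Definition nf_gen (g : generator) : normal_form :=
  if g is Some u then NGen u else NZero.

Definition nf (s : seq generator) : normal_form :=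
  foldr (fun g => nf_mul (nf_gen g)) NOne s.

Lemma edge_le3 e : e \in E -> #|e| <= 3.
Proof. by case: H3 => <- _ _ _ _ eE; apply: (bigmax_sup e). Qed.

Lemma edge_ge2 e : e \in E -> 1 < #|e|.
Proof. by case: H3 => _ _ _ h _ /h. Qed.

Lemma edge_linear e f x y : e \in E -> f \in E -> x != y ->
  x \in e -> x \in f -> y \in e -> y \in f -> e = f.
Proof.
case: H3 => _ lin _ _ _ eE fE xy xe xf ye yf; apply/eqP/negPn/negP => ef.
have := lin e f eE fE ef; apply/negP; rewrite -ltnNge.
have <- : #|[set x; y]| = 2 by rewrite cards2 xy.
by apply/subset_leq_card/subsetP => z /set2P[]->; rewrite inE ?xe ?xf ?ye ?yf.
Qed.

Lemma edge2_disjoint e f x : e \in E -> f \in E -> #|e| = 2 ->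
  x \in e -> x \in f -> f = e.
Proof.
case: H3 => _ _ _ _ dis eE fE e2 xe xf; apply/eqP/negPn/negP => ef.
by have /pred0P/(_ x) := dis e f eE fE e2 ef; rewrite /= xe xf.
Qed.

Lemma ex_edge3 : exists2 e, e \in E & #|e| = 3.
Proof.
case: H3 => m3 _ _ _ _.
have E0 : 0 < #|E|.
  rewrite lt0n; apply/negP => /eqP/cards0_eq E0.
  by move: m3; rewrite E0 big_set0.
have [e eE e3] := eq_bigmax_cond (fun e : {set V} => #|e|) E0.
by exists e => //; rewrite -e3.
Qed.

Lemma card_set3 (w u v : V) : u != v -> w \notin [set u; v] ->
  #|w |: [set u; v]| = 3.
Proof. by move=> uv wuv; rewrite cardsU1 wuv cards2 uv. Qed.

Lemma nf_mulC x y : nf_mul x y = nf_mul y x.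
Proof.
case: x y => [|||u|w] [|||v|w'] //=.
by rewrite eq_sym (setUC [set v] [set u]).
Qed.

Lemma nf_mul1 x : nf_mul x NOne = x.
Proof. by case: x. Qed.

Lemma nf_mul0 x : nf_mul x NZero = NZero.
Proof. by case: x. Qed.

Lemma nf_pairE u v w : u != v -> w \notin [set u; v] ->
  w |: [set u; v] \in E -> nf_mul (NGen u) (NGen v) = NPair w.
Proof.
move=> uv wuv wE /=; rewrite (negPf uv).
have uw : u \in w |: [set u; v] by rewrite !inE eqxx orbT.
have vw : v \in w |: [set u; v] by rewrite !inE eqxx !orbT.
case: ifP => [uvE|_].
  have eq := edge_linear uvE wE uv (set21 u v) uw (set22 u v) vw.
  by move: wuv; rewrite eq !inE eqxx.
case: pickP => [w' /andP[w'uv w'E]|/(_ w)]; last by rewrite wuv wE.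
have uw' : u \in w' |: [set u; v] by rewrite !inE eqxx orbT.
have vw' : v \in w' |: [set u; v] by rewrite !inE eqxx !orbT.
have eq := edge_linear wE w'E uv uw uw' vw vw'.
have : w \in w' |: [set u; v] by rewrite -eq setU11.
by rewrite in_setU1 (negPf wuv) orbF => /eqP ->.
Qed.

Variant nf_pair_spec (u v : V) : normal_form -> Prop :=
| NfPairEq of u = v : nf_pair_spec u v NZero
| NfPairEdge of u != v & [set u; v] \in E : nf_pair_spec u v NTop
| NfPairSub w of u != v & w \notin [set u; v] & w |: [set u; v] \in E :
    nf_pair_spec u v (NPair w)
| NfPairNone of u != v & ~~ subhyperedge [set u; v] : nf_pair_spec u v NZero.

Lemma nf_pairP u v : nf_pair_spec u v (nf_mul (NGen u) (NGen v)).
Proof.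
case: (eqVneq u v) => [-> /=|uv]; first by rewrite eqxx; apply: NfPairEq.
case: (boolP ([set u; v] \in E)) => uvE.
  by rewrite /= (negPf uv) uvE; apply: NfPairEdge.
case: (pickP (fun w => (w \notin [set u; v]) && (w |: [set u; v] \in E))).
  by move=> w /andP[wuv wE]; rewrite (nf_pairE uv wuv wE); apply: NfPairSub.
move=> no; rewrite /= (negPf uv) (negPf uvE).
case: pickP => [w|_]; first by rewrite no.
apply: NfPairNone => //; apply/negP => /andP[_ /exists_inP[e eE uve]].
have u2 : #|[set u; v]| = 2 by rewrite cards2 uv.
have [d|d] := eqVneq (#|e :\: [set u; v]|) 0.
  suff eq : [set u; v] = e by rewrite eq eE in uvE.
  by apply/eqP; rewrite eqEsubset uve -setD_eq0 -cards_eq0 d.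
have [w] : exists w, w \in e :\: [set u; v].
  by apply/set0Pn; rewrite -cards_eq0.
rewrite inE => /andP[wuv we].
suff eq : w |: [set u; v] = e by have := no w; rewrite wuv eq eE.
apply/eqP; rewrite eqEcard (card_set3 uv wuv) edge_le3 // andbT.
by rewrite subUset sub1set we.
Qed.

Lemma nf_tripleE u v h : nf_mul (nf_mul (NGen u) (NGen v)) (NGen h) =
  if uniq [:: u; v; h] && ([set u; v; h] \in E) then NTop else NZero.
Proof.
have setE : [set u; v; h] = h |: [set u; v] by rewrite setUC.
have -> : uniq [:: u; v; h] = (u != v) && (u != h) && (v != h).
  by rewrite /= !inE negb_or andbT.
rewrite setE; case: nf_pairP => [->|uv uvE|w uv wuv wE|uv nsub] /=; first by rewrite eqxx.
- case: ifP => // /andP[/andP[/andP[_ uh] vh] hE].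
  have uvh : h \notin [set u; v] by rewrite !inE negb_or ![h == _]eq_sym uh.
  by have := nf_pairE uv uvh hE; rewrite /= (negPf uv) uvE.
- case: eqP => [->|hw].
    rewrite wE uv; move: wuv.
    by rewrite !inE negb_or ![w == _]eq_sym => /andP[-> ->].
  case: ifP => // /andP[/andP[/andP[_ uh] vh] hE].
  have uvh : h \notin [set u; v] by rewrite !inE negb_or ![h == _]eq_sym uh.
  by have := nf_pairE uv uvh hE; rewrite (nf_pairE uv wuv wE) => -[/esym].
- case: ifP => // /andP[_ hE]; case/negP: nsub; apply/andP; split.
    by apply/set0Pn; exists u; rewrite set21.
  by apply/exists_inP; exists (h |: [set u; v]); rewrite ?subsetUr.
Qed.

Lemma nf_mulA : associative nf_mul.
Proof.
have gen2 u v : nf_mul (NGen u) (NGen v) <> NOne /\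
    (forall w, nf_mul (NGen u) (NGen v) <> NGen w).
  by case: nf_pairP.
have genP u w : nf_mul (NGen u) (NPair w) = NTop \/
    nf_mul (NGen u) (NPair w) = NZero.
  by rewrite /=; case: eqP; [left|right].
have top z : z <> NOne -> nf_mul NTop z = NZero by case: z.
have topr z : z <> NOne -> nf_mul z NTop = NZero by case: z.
have pairP z w : z <> NOne -> (forall u, z <> NGen u) ->
    nf_mul z (NPair w) = NZero.
  by case: z => // v _ /(_ v).
have zero z : nf_mul NZero z = NZero by case: z.
case=> [|||u|w] y z //.
- by rewrite [in RHS]zero zero zero.
- case: y => [|||v|w] //; rewrite ?zero //.
  + by case: z.
  + apply: top.
    by case: z => // v'; [case: (gen2 v v')|rewrite /=; case: eqP].
  + apply: top.
    by case: z => // v'; rewrite /=; case: eqP.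
- case: y => [|||v|w] //; rewrite ?nf_mul0 ?zero ?nf_mul0 //.
  + by case: z.
  + case: z => [|||h|w].
    * by rewrite !nf_mul1.
    * by rewrite !nf_mul0.
    * by rewrite (topr (NGen v)) // nf_mul0 topr //; case: (gen2 u v).
    * rewrite nf_tripleE nf_mulC nf_tripleE; congr (if _ then _ else _).
      rewrite [[set v; h; u]]setUC setUA; congr (_ && _).
      rewrite /= !inE !negb_or (eq_sym v u) (eq_sym h u) !andbT.
      by case: (u == v); case: (u == h); case: (v == h).
    * have [n1 n2] := gen2 u v; rewrite (pairP _ w n1 n2).
      by have [->| ->] := genP v w; rewrite ?nf_mul0 ?topr.
  + case: z => [|||h|w'].
    * by rewrite !nf_mul1.
    * by rewrite !nf_mul0.
    * by have [->|->] := genP u w.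
    * rewrite [nf_mul (NPair w) _]nf_mulC.
      by have [->|->] := genP u w; have [->|->] := genP h w.
    * by have [->|->] := genP u w.
- case: y => [|||v|w'] //; rewrite ?nf_mul0 ?zero ?nf_mul0 //.
  + by case: z.
  + have -> : nf_mul (nf_mul (NPair w) (NGen v)) z =
        if z is NOne then nf_mul (NPair w) (NGen v) else NZero.
      by rewrite /=; case: eqP => _; case: z.
    case: z => [|||h|w''] //.
      by case: (nf_pairP v h).
    by rewrite /=; case: eqP.
  + by case: z => [|||h|w''] //=; case: eqP.
Qed.

Lemma nf_cat s t : nf (s ++ t) = nf_mul (nf s) (nf t).
Proof. by elim: s => //= g s ->; rewrite nf_mulA. Qed.

Lemma nf_edge s : uniq s -> [set:: s] \in E -> nf (map Some s) = NTop.
Proof.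
move=> us sE; have ss : #|[set:: s]| = size s.
  by rewrite -(card_uniqP us); apply: eq_card => x; rewrite inE.
move: (edge_ge2 sE) (edge_le3 sE); rewrite ss.
case: s us sE {ss} => [|u [|v [|h [|]]]] // us sE _ _.
  rewrite [nf _]/= -/(nf_mul (NGen u) (NGen v)).
  have eq : [set:: [:: u; v]] = [set u; v] by apply/setP => x; rewrite !inE.
  by move: us; rewrite /= inE andbT -eq sE => /negPf ->.
rewrite -[nf _]/(nf_mul (NGen u) (nf_mul (NGen v) (NGen h))) nf_mulA nf_tripleE.
rewrite us; suff -> : [set u; v; h] = [set:: [:: u; v; h]] by rewrite sE.
by apply/setP => x; rewrite !inE orbA.
Qed.

Lemma linkedE u v r l : linked [set u; v] [set r; l] ->
  nf_mul (NGen u) (NGen v) = nf_mul (NGen r) (NGen l).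
Proof.
case/and3P => _ _ /existsP[w /and3P[]].
rewrite in_setU negb_or => /andP[w1 w2] E1 E2.
have sing (x y z t : V) : w \notin [set x; x] -> w |: [set x; x] \in E ->
    w \notin [set z; t] -> w |: [set z; t] \in E -> z = t.
  move=> wx xE wzt ztE; apply/eqP/negPn/negP => zt.
  have c2 : #|w |: [set x; x]| = 2 by rewrite setUid cards2 -in_set1 -(setUid [set x]) wx.
  have eq := edge2_disjoint xE ztE c2 (setU11 _ _) (setU11 _ _).
  by have := card_set3 zt wzt; rewrite eq c2.
have [uv|uv] := eqVneq u v.
  move: w1 E1; rewrite -uv => w1 E1.
  by rewrite -(sing u u r l w1 E1 w2 E2) /= !eqxx.
have [rl|rl] := eqVneq r l.
  move: w2 E2; rewrite -rl => w2 E2.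
  by move/eqP: uv; case; apply: (sing r r u v w2 E2 w1 E1).
by rewrite (nf_pairE uv w1 E1) (nf_pairE rl w2 E2).
Qed.

Lemma nf_relation s t : sg_relation s t -> nf s = nf t.
Proof.
case=> {s t} [u v|u|u||u v|u v h|ui uj ur ul|s t] //.
- exact: (nf_mulC (NGen u) (NGen v)).
- move=> uv; rewrite -[nf _]/(nf_mul (NGen u) (NGen v)) -[RHS]/NZero.
  case: nf_pairP uv => [//|nuv|w nuv wuv wE|//]; rewrite (negPf nuv) /=.
    move=> uvE /negP[]; apply/andP; split.
      by apply/set0Pn; exists u; rewrite set21.
    by apply/exists_inP; exists [set u; v].
  case/negP; apply/andP; split; first by apply/set0Pn; exists u; rewrite set21.
  by apply/exists_inP; exists (w |: [set u; v]); rewrite ?subsetUr.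
- move=> uvh; rewrite -[nf _]/(nf_mul (NGen u) (nf_mul (NGen v) (NGen h))).
  by rewrite nf_mulA nf_tripleE (negPf uvh) andbF.
- by move=> /linkedE.
- by move=> us sE ut tE; rewrite !nf_edge.
Qed.

Lemma nf_congr s t : sg_congr s t -> nf s = nf t.
Proof.
elim=> {s t} [p s t q st|//|//|s t r _ -> //].
by rewrite !nf_cat (nf_relation st).
Qed.

(* [NPair w] is the normal form of a word only if w lies in a 3-element
   hyperedge. *)
Definition nf_reached (x : normal_form) : Prop :=
  if x is NPair w then exists u v,
    [/\ u != v, w \notin [set u; v] & w |: [set u; v] \in E]
  else True.

Lemma nf_mul_reached x y : nf_reached x -> nf_reached y ->
  nf_reached (nf_mul x y).
Proof.
case: x y => [|||u|w] [|||v|w'] //= _ _; try by case: eqP.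
rewrite -/(nf_mul (NGen u) (NGen v)).
by case: nf_pairP => // w uv wuv wE; exists u, v.
Qed.

Lemma nfP s : nf_reached (nf s).
Proof. by elim: s => //= g s; apply: nf_mul_reached; case: g. Qed.

Lemma sg_congr_cat (p s t q : seq generator) :
  sg_congr s t -> sg_congr (p ++ s ++ q) (p ++ t ++ q).
Proof.
elim=> {s t} [p' s t q' st|s|s t _|s t r _ st _].
- rewrite -!catA (catA p) (catA p p'); exact: sg_congr_rel.
- exact: sg_congr_refl.
- exact: sg_congr_sym.
- exact: sg_congr_trans.
Qed.

Lemma sg_congr_gen (s t : seq generator) : sg_relation s t -> sg_congr s t.
Proof. by move=> /(sg_congr_rel [::] [::]); rewrite /= !cats0. Qed.

Lemma sg_congr_zerol (s : seq generator) : sg_congr (None :: s) [:: None].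
Proof.
elim: s => [|g s IH]; first exact: sg_congr_refl.
apply: sg_congr_trans IH; apply: (@sg_congr_rel _ [::] [:: None; g] [:: None] s).
by case: g => [u|]; [exact: sg_zerol|exact: sg_zero2].
Qed.

(* The words serving as representatives of the normal form x; they are unique
   only up to congruence. *)
Definition nf_word (x : normal_form) (s : seq generator) : Prop :=
  match x with
  | NOne => s = [::]
  | NZero => s = [:: None]
  | NTop => exists p q r, [/\ uniq [:: p; q; r], [set p; q; r] \in E &
              s = map Some [:: p; q; r]]
  | NGen u => s = [:: Some u]
  | NPair w => exists p q, [/\ p != q, w \notin [set p; q],
                 w |: [set p; q] \in E & s = map Some [:: p; q]]
  end.

Lemma set3E (p q r : V) : [set:: [:: p; q; r]] = [set p; q; r].
Proof. by apply/setP => x; rewrite !inE orbA. Qed.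

Lemma set2E (p q : V) : [set:: [:: p; q]] = [set p; q].
Proof. by apply/setP => x; rewrite !inE. Qed.

Lemma nf_word_congr x s t : nf_word x s -> nf_word x t -> sg_congr s t.
Proof.
case: x => [|||u|w] /=; try by move=> -> ->; apply: sg_congr_refl.
  case=> [p [q [r [us sE ->]]]] [p' [q' [r' [ut tE ->]]]].
  apply: sg_congr_gen.
  by apply: (@sg_edge _ [:: p; q; r] [:: p'; q'; r']); rewrite ?set3E.
case=> [p [q [pq wpq wE ->]]] [p' [q' [pq' wpq' wE' ->]]].
apply: sg_congr_gen; apply: sg_linked.
have sub (a b : V) : w |: [set a; b] \in E -> subhyperedge [set a; b].
  move=> abE; apply/andP; split; first by apply/set0Pn; exists a; rewrite set21.
  by apply/exists_inP; exists (w |: [set a; b]); rewrite ?subsetUr.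
rewrite /linked !sub //=; apply/existsP; exists w.
by rewrite in_setU negb_or wpq wpq' wE wE'.
Qed.

Lemma ex_nf_word x : nf_reached x -> exists s, nf_word x s.
Proof.
case: x => [|||u|w] /=; try by move=> _; eexists.
  move=> _; have [e eE e3] := ex_edge3.
  have [p [q [r [pq qr pr eq]]]] : exists p q r,
      [/\ p != q, q != r, p != r & e = [set p; q; r]].
    have := enum_uniq e; have : size (enum e) = 3 by rewrite -cardE.
    have mem_e : forall x, (x \in enum e) = (x \in e) by move=> x; rewrite mem_enum.
    case: (enum e) mem_e => [|p [|q [|r []]]] // mem_e _.
    rewrite /= !inE !negb_or andbT => /andP[/andP[pq pr] qr].
    exists p, q, r; split=> //.
    by apply/setP => x; rewrite -mem_e !inE orbA.
  exists (map Some [:: p; q; r]), p, q, r; rewrite -eq eE /= !inE negb_or.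
  by rewrite pq pr qr.
by case=> p [q [pq wpq wE]]; exists (map Some [:: p; q]), p, q.
Qed.

Lemma nf_word_mul g x s t : nf_reached x -> nf_word x s ->
  nf_word (nf_mul (nf_gen g) x) t -> sg_congr (g :: s) t.
Proof.
case: g => [u|] _; last first.
  move=> _ tE; apply: sg_congr_trans (sg_congr_zerol s) _.
  by move: tE; rewrite nf_mulC nf_mul0 => ->; apply: sg_congr_refl.
case: x => [|||v|w].
- by move=> -> ->; apply: sg_congr_refl.
- by move=> -> ->; apply: sg_congr_gen; apply: sg_zeror.
- case=> [p [q [r [us sE ->]]]] ->.
  have [up|up] := eqVneq u p.
    apply: sg_congr_trans (sg_congr_zerol (map Some [:: q; r])).
    apply: (@sg_congr_rel _ [::] [:: Some u; Some p] [:: None]).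
    by apply: sg_pair; rewrite up eqxx.
  have [uq|uq] := eqVneq u q.
    apply: (@sg_congr_trans _ _ (Some u :: Some q :: map Some [:: p; r])).
      apply: (@sg_congr_rel _ [:: Some u] [:: Some p; Some q]
                [:: Some q; Some p] [:: Some r]); exact: sg_comm.
    apply: sg_congr_trans (sg_congr_zerol (map Some [:: p; r])).
    apply: (@sg_congr_rel _ [::] [:: Some u; Some q] [:: None]).
    by apply: sg_pair; rewrite uq eqxx.
  have pq : p != q by move: us; rewrite /= !inE negb_or => /andP[/andP[]].
  have [upqE|upqE] := boolP ([set u; p; q] \in E); last first.
    apply: (@sg_congr_trans _ _ [:: None; Some r]); last exact: sg_congr_zerol.
    apply: (@sg_congr_rel _ [::] [:: Some u; Some p; Some q] [:: None] [:: Some r]).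
    exact: sg_triple.
  have eq : [set u; p; q] = [set p; q; r].
    by apply: (edge_linear upqE sE pq); rewrite !inE eqxx ?orbT.
  have ur : u = r.
    have : u \in [set p; q; r] by rewrite -eq !inE eqxx.
    by rewrite !inE (negPf up) (negPf uq) => /eqP.
  rewrite -ur.
  apply: (@sg_congr_trans _ _ (Some u :: Some p :: map Some [:: u; q])).
    apply: (@sg_congr_rel _ [:: Some u; Some p] [:: Some q; Some u]
              [:: Some u; Some q] [::]); exact: sg_comm.
  apply: (@sg_congr_trans _ _ (Some u :: Some u :: map Some [:: p; q])).
    apply: (@sg_congr_rel _ [:: Some u] [:: Some p; Some u]
              [:: Some u; Some p] [:: Some q]); exact: sg_comm.
  apply: sg_congr_trans (sg_congr_zerol (map Some [:: p; q])).
  apply: (@sg_congr_rel _ [::] [:: Some u; Some u] [:: None]).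
  by apply: sg_pair; rewrite eqxx.
- move=> ->; rewrite [nf_gen _]/=.
  case: nf_pairP => [-> ->|uv uvE tE|w uv wuv wE tE|uv nsub ->].
  + by apply: sg_congr_gen; apply: sg_pair; rewrite eqxx.
  + case: tE => [p [q [r [us sE ->]]]].
    apply: sg_congr_gen.
    apply: (@sg_edge _ [:: u; v] [:: p; q; r]); rewrite ?set3E ?set2E //.
    by rewrite /= inE uv.
  + by apply: (@nf_word_congr (NPair w)) => //; exists u, v.
  + by apply: sg_congr_gen; apply: sg_pair; rewrite nsub orbT.
- case=> [p [q [pq wpq wE ->]]] /=; have [->|uw] := eqVneq u w.
    apply: (@nf_word_congr NTop); exists w, p, q; split=> //; last by rewrite -setUA.
    by move: wpq; rewrite /= !inE !negb_or pq => ->.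
  move=> ->; apply: sg_congr_gen; apply: sg_triple; rewrite -setUA; apply/negP => upqE.
  have eq : u |: [set p; q] = w |: [set p; q].
    by apply: (edge_linear upqE wE pq); rewrite !inE eqxx ?orbT.
  have : w \in u |: [set p; q] by rewrite eq setU11.
  by rewrite in_setU1 (negPf wpq) orbF eq_sym (negPf uw).
Qed.

Lemma nf_wordP s t : nf_word (nf s) t -> sg_congr s t.
Proof.
elim: s t => [|g s IH] t; first by move=> ->; apply: sg_congr_refl.
have [r sr] := ex_nf_word (nfP s).
move=> /(nf_word_mul (nfP s) sr); apply: sg_congr_trans.
by have := sg_congr_cat [:: g] [::] (IH _ sr); rewrite /= !cats0.
Qed.

Lemma sg_congrP (s t : seq generator) : sg_congr s t <-> nf s = nf t.
Proof.
split=> [|st]; first exact: nf_congr.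
have [r sr] := ex_nf_word (nfP s).
apply: (sg_congr_trans (nf_wordP sr)); apply: sg_congr_sym.
by apply: nf_wordP; rewrite -st.
Qed.

Definition sg_nf (x : semigroup) : normal_form := nf (val (repr x)).

Lemma sg_nf_pi (w : word) : sg_nf (\pi_(semigroup) w)%qT = nf (val w).
Proof.
apply/sg_congrP; set q := (\pi w)%qT.
have /eqmodP/asboolP // : (repr q = w %[mod semigroup])%qT by rewrite reprK.
Qed.

Lemma sg_nf_inj : injective sg_nf.
Proof.
move=> x y xy; rewrite -[x]reprK -[y]reprK.
by apply/eqmodP; apply/asboolP/sg_congrP.
Qed.

Lemma sg_nf_mul x y : sg_nf (sg_mul x y) = nf_mul (sg_nf x) (sg_nf y).
Proof. by rewrite /sg_mul -lock sg_nf_pi nf_cat. Qed.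

Lemma sg_nf_zero : sg_nf (sg_zero H) = NZero.
Proof. by rewrite sg_nf_pi. Qed.

Lemma sg_nf_reached x : nf_reached (sg_nf x).
Proof. exact: nfP. Qed.

Lemma sg_nf_neq1 x : sg_nf x <> NOne.
Proof.
rewrite /sg_nf; case: (repr x) => -[//|g s] _ /=.
by case: (nf s) g => [|||v|w] [u|] //=; case: eqP => //; do ![case: ifP => //]; case: pickP.
Qed.

Lemma sg_mulA : associative (@sg_mul H).
Proof. by move=> x y z; apply: sg_nf_inj; rewrite !sg_nf_mul nf_mulA. Qed.

Lemma sg_mulC : commutative (@sg_mul H).
Proof. by move=> x y; apply: sg_nf_inj; rewrite !sg_nf_mul nf_mulC. Qed.

Lemma sg_mul0 x : sg_mul x (sg_zero H) = sg_zero H.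
Proof. by apply: sg_nf_inj; rewrite sg_nf_mul sg_nf_zero nf_mul0. Qed.

Lemma nf_cancel x y z : nf_reached y -> nf_reached z ->
  x <> NOne -> y <> NOne -> z <> NOne ->
  nf_mul x y = nf_mul x z -> nf_mul x y <> NZero -> y = z.
Proof.
have mixed u v w : nf_reached (NPair w) ->
    nf_mul (NGen u) (NGen v) <> nf_mul (NGen u) (NPair w) \/
    nf_mul (NGen u) (NGen v) = NZero.
  move=> [a [b [ab wab abE]]].
  case: nf_pairP => [_|uv uvE|w' _ _ _|_ _]; try by right.
    left => /=; case: eqP => // uw _.
    have c2 : #|[set u; v]| = 2 by rewrite cards2 uv.
    have uab : u \in w |: [set a; b] by rewrite uw setU11.
    have eq := edge2_disjoint uvE abE c2 (set21 u v) uab.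
    by have := card_set3 ab wab; rewrite eq c2.
  by left => /=; case: eqP.
case: x => [|||u|w] //; case: y => [|||v|w1] // gy; case: z => [|||h|w2] // gz;
  move=> _ _ _; rewrite ?nf_mul0 //.
- case: (nf_pairP u v) => [//|uv uvE|w uv wuv wE|//].
    case: (nf_pairP u h) => [//|uh uhE _ _|//|//].
    have c2 : #|[set u; v]| = 2 by rewrite cards2 uv.
    have eq := edge2_disjoint uvE uhE c2 (set21 u v) (set21 u h).
    have : h \in [set u; v] by rewrite -eq set22.
    by rewrite !inE eq_sym (negPf uh) => /eqP ->.
  case: (nf_pairP u h) => [//|//|w' uh wuh w'E [ww'] _|//].
  move: wuh w'E; rewrite -{w'}ww' => wuh w'E.
  have wu : w != u by move: wuv; rewrite !inE negb_or => /andP[].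
  have eq : w |: [set u; v] = w |: [set u; h].
    by apply: (edge_linear wE w'E wu); rewrite !inE eqxx ?orbT.
  have : h \in w |: [set u; v] by rewrite eq !inE eqxx !orbT.
  rewrite !inE ![h == _]eq_sym (negPf uh) /=.
  by move: wuh; rewrite !inE negb_or => /andP[_ /negPf ->] /eqP ->.
- by have [|] := mixed u v w2 gz.
- by have [|e1 e2 nz] := mixed u h w1 gy; [move=> n e; case: n|case: nz; rewrite e2].
- by rewrite /=; case: eqP => [<-|//]; case: eqP => [<-|].
- by rewrite /=; case: eqP => [->|//]; case: eqP => [->|].
Qed.

Lemma sg_zero_cancel (x y z : semigroup) :
  sg_mul x y = sg_mul x z -> sg_mul x y <> sg_zero H -> y = z.
Proof.
move=> xyz nz; apply: sg_nf_inj.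
apply: (@nf_cancel (sg_nf x)); try exact: sg_nf_reached; try exact: sg_nf_neq1.
  by rewrite -!sg_nf_mul xyz.
by rewrite -sg_nf_mul -sg_nf_zero => /sg_nf_inj.
Qed.

Lemma flat_addC : commutative (@flat_add H).
Proof. by move=> x y; rewrite /flat_add eq_sym; case: eqP. Qed.

Lemma flat_addA : associative (@flat_add H).
Proof.
have addxx x : flat_add x x = x by rewrite /flat_add eqxx.
have add_neq x y : x != y -> flat_add x y = sg_zero H.
  by rewrite /flat_add => /negPf ->.
have addx0 x : flat_add x (sg_zero H) = sg_zero H.
  by rewrite /flat_add; case: eqP.
move=> x y z; case: (eqVneq x y) => [<-|xy].
  by case: (eqVneq x z) => [<-|xz]; rewrite !addxx // (add_neq x z).
case: (eqVneq y z) => [<-|yz].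
  by rewrite addxx (add_neq x y) // flat_addC addx0.
by rewrite (add_neq x y) // (add_neq y z) // addx0 flat_addC addx0.
Qed.

Lemma flat_mulDr : right_distributive (@sg_mul H) (@flat_add H).
Proof.
move=> x y z; rewrite /flat_add.
case: (eqVneq y z) => [->|yz]; first by rewrite eqxx.
rewrite sg_mul0; case: eqP => // xyz; apply/esym/eqP/negPn/negP => /eqP nz.
by case/eqP: yz; apply: sg_zero_cancel xyz nz.
Qed.

Lemma flat_algebra_semiring : is_semiring (flat_algebra H).
Proof.
split; [exact: flat_addA|exact: flat_addC|exact: sg_mulA| |exact: flat_mulDr].
by move=> x y z; rewrite /= sg_mulC flat_mulDr !(sg_mulC z).
Qed.

End NormalForms.

Definition hypergraph_semiring (H : hypergraph3) : semiring :=
  Semiring (flat_algebra_semiring (hypergraph3P H)).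

(* Main.v *)
(** Subdirect irreducibility: in S_H every nonzero element divides the top
    element, so a homomorphism identifying two distinct elements identifies the
    top element with 0.

    Nonfinite basis: given n, take a digraph that has no proper colouring by
    |V(H)| + 1 colours but all of whose small subgraphs are bipartite (the shift
    digraph on words without repeated letters), and let G be the 3-hypergraph
    whose hyperedges are {source y, target y, y} for the arcs y.  The sum t of
    the products over all hyperedges of G satisfies t = t t in S_H, where t
    vanishes because a nonzero value would properly colour the digraph by
    vertices of H; in S_G it takes the top value and t t = 0.  On the other hand
    every identity of S_H in fewer than n variables holds in S_G: a failure
    involves at most n vertices of G, and these can be 3-coloured, hence mapped
    to one 3-element hyperedge of H, in a way that preserves the failure. *)

From HB Require Import structures.
From mathcomp Require Import all_boot.
From mathcomp Require Import boolp.
Require Import Defs.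

Set Implicit Arguments.
Unset Strict Implicit.
Unset Printing Implicit Defensive.

(** * Factors of products of normal forms, and codivisors of the top element *)

Section NormalFormProducts.
Variable H : hypergraph.
Hypothesis H3 : is_hypergraph3 H.
Local Notation V := (vertex H).
Local Notation E := (hyperedges H).
Local Notation nform := (normal_form H).
Local Notation semigroup := (hypergraph_semigroup H).
Implicit Types (x y z : nform) (u v w : V).

Lemma nf_mul_neq1 x y : x <> NOne H -> y <> NOne H -> nf_mul x y <> NOne H.
Proof.
case: x y => [|||u|w] [|||v|w'] // _ _; try by move=> /=; case: eqP.
by case: nf_pairP.
Qed.

Lemma nf_mul_neq_gen x y u :
  x <> NOne H -> y <> NOne H -> nf_mul x y <> NGen u.
Proof.
case: x y => [|||u'|w] [|||v|w'] // _ _; try by move=> /=; case: eqP.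
by case: nf_pairP.
Qed.

Lemma nf_mul_neq_pair x y w : x <> NOne H -> y <> NOne H ->
  (forall u, y <> NGen u) -> nf_mul x y <> NPair w.
Proof.
case: x y => [|||u|w'] [|||v|w''] // _ _ ng; try by move=> /=; case: eqP.
  by case: (ng v).
Qed.

Lemma nf_mul_topP x y : x <> NOne H -> y <> NOne H ->
  (forall u, y <> NGen u) -> nf_mul x y = NTop H ->
  exists2 u, x = NGen u & y = NPair u.
Proof.
case: x y => [|||u|w'] [|||v|w''] // _ _ ng; try by case: (ng v).
by rewrite /=; case: eqP => // <- _; exists u.
Qed.

Lemma nf_mul_neq0 x y : nf_mul x y <> NZero H -> x <> NZero H /\ y <> NZero H.
Proof.
by move=> nz; split=> e; apply: nz; rewrite e ?nf_mul0 // nf_mulC nf_mul0.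
Qed.

(** A product of two nontrivial factors that still has a nonzero nontrivial multiple must be some
    [NPair w], and these products arise only from two distinct generators. *)
Lemma nf_mul3_neq0 x y z : x <> NOne H -> y <> NOne H -> z <> NOne H ->
  nf_mul (nf_mul x y) z <> NZero H ->
  exists u v, [/\ x = NGen u, y = NGen v & u != v].
Proof.
move=> x1 y1 z1 nz; have [xy0 z0] := nf_mul_neq0 nz.
case: x y z x1 y1 z1 nz xy0 z0 => [|||u|w] [|||v|w'] // z _ _ z1;
  try by rewrite /=; case: eqP => // _; case: z z1.
case: nf_pairP => // uv; last by move=> ? ? _; exists u, v.
by move=> _; case: z z1.
Qed.

Lemma nf_word_nf x s : nf_word x s -> nf s = x.
Proof.
case: x => [|||u|w] /=; try by move=> ->.
  case=> p [q [r [us sE ->]]]; apply: (nf_edge H3 (s := [:: p; q; r])) => //.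
  by rewrite set3E.
case=> p [q [pq wpq wE ->]].
exact: (nf_pairE H3 pq wpq wE).
Qed.

Lemma ex_sg_nf x : nf_reached x -> x <> NOne H ->
  exists a : semigroup, sg_nf a = x.
Proof.
move=> xr x1; have [s /nf_word_nf sx] := ex_nf_word H3 xr.
have s0 : s != [::] by apply: contra_notN x1 => /eqP s0; rewrite -sx s0.
by exists (\pi_(semigroup) (Sub s s0))%qT; rewrite (sg_nf_pi H3) SubK.
Qed.

Lemma nf_gen_pair u : nf_mul (NGen u) (NPair u) = NTop H.
Proof. by rewrite /= eqxx. Qed.

Lemma cover_edge u : exists2 e, e \in E & u \in e.
Proof.
have : u \in cover E by case: H3 => _ _ -> _ _; rewrite inE.
by case/bigcupP => e; exists e.
Qed.

(** For [NGen u], a hyperedge through [u] leaves either one vertex [v], giving [NGen v], or two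
    vertices, whose product is [NPair u]. For [NPair w] the codivisor is [NGen w]. *)
Lemma nf_codivisor x : nf_reached x -> x <> NZero H -> x <> NOne H ->
  x <> NTop H ->
  exists y, [/\ nf_reached y, y <> NOne H & nf_mul x y = NTop H].
Proof.
case: x => [|||u|w] // xr _ _ _; last first.
  by exists (NGen w); split=> //; rewrite nf_mulC nf_gen_pair.
have [e eE ue] := cover_edge u.
have : #|e| = #|e :\ u|.+1 by rewrite (cardsD1 u e) ue.
have [e2|e2] := eqVneq #|e| 2.
  rewrite e2 => -[] /esym/eqP/cards1P[v eu].
  have vu : v \in e :\ u by rewrite eu set11.
  exists (NGen v); split=> //=; have [uv|uv] := eqVneq u v.
    by move: vu; rewrite -uv !inE eqxx.
  by rewrite -eu setD1K ?eE.
have e3 : #|e| = 3.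
  apply/eqP; rewrite eqn_leq (edge_le3 H3 eE) ltn_neqAle.
  by rewrite eq_sym e2 (edge_ge2 H3 eE).
move=> c3; have {c3} : #|e :\ u| == 2 by rewrite -eqSS -c3 e3.
case/cards2P => p [q [pq eu]].
exists (NPair u); split=> //; last by rewrite nf_gen_pair.
exists p, q; split=> //; rewrite -eu ?setD1K //.
by rewrite !inE eqxx.
Qed.

Lemma sg_codivisor (a : semigroup) : a <> sg_zero H -> sg_nf a <> NTop H ->
  exists b, sg_nf (sg_mul a b) = NTop H.
Proof.
move=> a0 at_.
have a0' : sg_nf a <> NZero H by rewrite -(sg_nf_zero H3) => /(sg_nf_inj H3).
have [y [yr y1 ay]] :=
  nf_codivisor (sg_nf_reached H3 a) a0' (@sg_nf_neq1 H a) at_.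
by have [b yb] := ex_sg_nf yr y1; exists b; rewrite (sg_nf_mul H3) yb.
Qed.

End NormalFormProducts.

(** * Subdirect irreducibility of S_H *)

Section SubdirectlyIrreducible.
Variable H : hypergraph3.
Local Notation S := (hypergraph_semiring H).
Let H3 := hypergraph3P H.

Lemma sg_nf_top_neq0 (a : S) : sg_nf a = NTop H -> a <> sg_zero H.
Proof. by move=> at_ a0; move: at_; rewrite a0 (sg_nf_zero H3). Qed.

(* A homomorphism identifying two distinct elements identifies the top element
   with zero: multiply by a codivisor of one of them, then add the top. *)
Lemma noninjective_collapse (B : algebra) (g : S -> B) (x y t : S) :
  homomorphism g -> sg_nf t = NTop H -> x <> y -> g x = g y ->
  g t = g (sg_zero H).
Proof.
move=> [gD gM] tt.
have collapse z : z <> t -> g t = g z -> g t = g (sg_zero H).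
  move=> zt gtz; transitivity (g (add t z)).
    rewrite gD -gtz -gD; congr g.
    by rewrite /= /flat_add eqxx.
  by congr g; rewrite /= /flat_add; case: eqP => // e; case: zt.
have step (a b : S) : a <> sg_zero H -> a <> b -> g a = g b -> g t = g (sg_zero H).
  move=> a0 ab gab.
  have [at_|at_] := pselect (sg_nf a = NTop H).
    have ta : t = a by apply: (sg_nf_inj H3); rewrite tt.
    by rewrite -ta in ab gab; apply: collapse gab => e; case: ab.
  have [d ad] := sg_codivisor H3 a0 at_.
  have tad : t = @mul S a d by apply: (sg_nf_inj H3); rewrite tt.
  apply: (collapse (@mul S b d)); last by rewrite tad !gM gab.
  move=> bdt; case: ab; apply: (sg_zero_cancel H3 (x := d)).
    by rewrite !(sg_mulC H3 d); apply: etrans (esym tad) (esym bdt).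
  by rewrite (sg_mulC H3); apply: sg_nf_top_neq0.
move=> xy gxy; have [x0|x0] := pselect (x = sg_zero H); last exact: step gxy.
by apply: (step y x) => //; [move=> y0; case: xy; rewrite x0|move=> yx; case: xy].
Qed.

(** If no coordinate were injective, each would identify the top element with zero, and then so
    would [f]. An injective coordinate is already onto, hence an isomorphism. *)
Lemma hypergraph_semiring_sdi : subdirectly_irreducible S.
Proof.
move=> I B f [[fD fM] finj fsurj].
have fhom i : homomorphism (fun x => f x i).
  by split=> x y; rewrite ?fD ?fM.
have [t tt] : exists t : S, sg_nf t = NTop H by apply: (@ex_sg_nf _ H3 (NTop H)).
have [[i iinj]|noinj] := pselect (exists i, injective (fun x => f x i)).
  exists i; split=> //.
  pose g y := projT1 (cid (fsurj i y)).
  have gK y : f (g y) i = y by rewrite /g; case: cid.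
  by exists g => // x; apply: iinj; rewrite gK.
exfalso; apply: (sg_nf_top_neq0 tt); apply: finj.
apply: functional_extensionality_dep => i.
have [//|gne] := pselect (f t i = f (sg_zero H) i).
case: noinj; exists i => x y fxy.
have [//|xy] := pselect (x = y).
by case: gne; apply: (noninjective_collapse (fhom i) tt xy fxy).
Qed.

End SubdirectlyIrreducible.

(** * Expansion of terms into monomials, and their values in the flat semiring *)

Fixpoint mons (t : term) : seq (seq nat) :=
  match t with
  | Var n => [:: [:: n]]
  | Add t1 t2 => mons t1 ++ mons t2
  | Mul t1 t2 => [seq m1 ++ m2 | m1 <- mons t1, m2 <- mons t2]
  end.

Lemma mons_neq0 t : mons t != [::].
Proof.
elim: t => //= [t1 IH1 t2 _|t1 IH1 t2 IH2]; first by case: (mons t1) IH1.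
by case: (mons t1) (mons t2) IH1 IH2 => [|? ?] // [].
Qed.

Lemma mem_mons_neq0 t m : m \in mons t -> m != [::].
Proof.
elim: t m => [n|t1 IH1 t2 IH2|t1 IH1 t2 _] m /=.
- by rewrite inE => /eqP ->.
- by rewrite mem_cat => /orP[/IH1|/IH2].
- by case/allpairsP => -[m1 m2] /= [/IH1 + _ ->]; case: m1.
Qed.

Definition term_vars (t : term) : seq nat := undup (flatten (mons t)).

Lemma mem_term_vars t m i : m \in mons t -> i \in m -> i \in term_vars t.
Proof. by move=> mt im; rewrite mem_undup; apply/flattenP; exists m. Qed.

Section Monomials.
Variable H : hypergraph.
Hypothesis H3 : is_hypergraph3 H.
Local Notation V := (vertex H).
Local Notation E := (hyperedges H).
Local Notation nform := (normal_form H).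
Implicit Types (r : nat -> nform) (m : seq nat).

Definition mprod r m : nform := foldr (fun i => nf_mul (r i)) (NOne H) m.

Lemma mprod_cat r m1 m2 :
  mprod r (m1 ++ m2) = nf_mul (mprod r m1) (mprod r m2).
Proof. by elim: m1 => //= i m1 ->; rewrite (nf_mulA H3). Qed.

Lemma mprod_reached r m : (forall i, nf_reached (r i)) -> nf_reached (mprod r m).
Proof. by move=> rr; elim: m => //= i m IH; apply: (nf_mul_reached H3). Qed.

Lemma mprod_neq1 r m : (forall i, r i <> NOne H) -> m != [::] ->
  mprod r m <> NOne H.
Proof.
move=> r1; elim: m => //= i m IH _; have [->/=|m0] := eqVneq m [::].
  by rewrite nf_mul1.
exact: (nf_mul_neq1 H3 _ (IH m0)).
Qed.

Lemma mprod_neq_gen r i j m u : (forall i, r i <> NOne H) ->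
  mprod r [:: i, j & m] <> NGen u.
Proof.
move=> r1; apply: (nf_mul_neq_gen H3) => //.
exact: (@mprod_neq1 r (j :: m)).
Qed.

Lemma mprod_mem0 r i m : i \in m -> r i = NZero H -> mprod r m = NZero H.
Proof.
elim: m => //= j m IH; rewrite inE => /predU1P[<- ->|im ri].
  by rewrite nf_mulC nf_mul0.
by rewrite (IH im ri) nf_mul0.
Qed.

Variant mprod_top_spec r : seq nat -> Prop :=
| MprodTop1 i of r i = NTop H : mprod_top_spec r [:: i]
| MprodTop2 i j of nf_mul (r i) (r j) = NTop H : mprod_top_spec r [:: i; j]
| MprodTop3 i j k u v w of r i = NGen u & r j = NGen v & r k = NGen w &
    uniq [:: u; v; w] & [set u; v; w] \in E : mprod_top_spec r [:: i; j; k].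

(** With three or more factors, all but the first form a product, never a generator, so the top
    element forces [NGen u] times [NPair u]; and no product of three or more factors is a pair. *)
Lemma mprod_topP r m : (forall i, r i <> NOne H) -> mprod r m = NTop H ->
  mprod_top_spec r m.
Proof.
move=> r1; have pr1 := mprod_neq1 r1.
case: m => [|i [|j [|k m]]] //.
- by rewrite /= nf_mul1; apply: MprodTop1.
- by rewrite /= nf_mul1; apply: MprodTop2.
move=> top; have [u ri jkm] :=
  nf_mul_topP (r1 i) (pr1 [:: j, k & m] isT)
    (fun u => @mprod_neq_gen r j k m u r1) top.
case: m => [|l m] in top jkm *; last first.
  case: (@nf_mul_neq_pair _ (r j) (mprod r [:: k, l & m]) u) => //.
    exact: pr1.
  by move=> v; apply: mprod_neq_gen.
(* Moving the first factor to the end makes the other two the leading factors of a nonzero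
   product. *)
have nz : nf_mul (nf_mul (r j) (r k)) (r i) <> NZero H.
  by rewrite nf_mulC; move: top; rewrite /= nf_mul1 => ->.
have [v [w [rj rk vw]]] := nf_mul3_neq0 H3 (r1 j) (r1 k) (r1 i) nz.
move: top; rewrite /= nf_mul1 ri rj rk.
rewrite -[LHS]/(nf_mul (NGen u) (nf_mul (NGen v) (NGen w))).
rewrite (nf_mulA H3) (nf_tripleE H3); case: ifP => // /andP[uvw uvwE] _.
exact: (@MprodTop3 r i j k u v w).
Qed.

(** A flat sum is nonzero only when its summands agree. For a product whose expanded monomials all
    have the nonzero value [c], 0-cancellation forces the monomials of each factor to agree among
    themselves. *)
Lemma sg_nf_evalP (rho : nat -> flat_algebra H) t c : c <> NZero H ->
  sg_nf (eval rho t) = c <->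
  (forall m, m \in mons t -> mprod (fun i => sg_nf (rho i)) m = c).
Proof.
set r := fun i => sg_nf (rho i).
have r1 i : r i <> NOne H by exact: sg_nf_neq1.
have rr i : nf_reached (r i) by exact: (sg_nf_reached H3).
elim: t c => [n|t1 IH1 t2 IH2|t1 IH1 t2 IH2] c c0 /=.
- split=> [<- m|/(_ [:: n])]; first by rewrite inE => /eqP -> /=; rewrite nf_mul1.
  by rewrite inE eqxx /= nf_mul1 => /(_ isT).
- split=> [|all_c].
    rewrite /flat_add; case: eqP => [e ec m|_].
      rewrite mem_cat => /orP[mt|mt]; first exact: (IH1 c c0).1 mt.
      by apply: (IH2 c c0).1 mt; rewrite -e.
    by rewrite (sg_nf_zero H3) => /esym.
  have e1 : sg_nf (eval rho t1) = c.
    by apply/(IH1 c c0) => m mt; apply: all_c; rewrite mem_cat mt.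
  have e2 : sg_nf (eval rho t2) = c.
    by apply/(IH2 c c0) => m mt; apply: all_c; rewrite mem_cat mt orbT.
  by rewrite /flat_add (sg_nf_inj H3 (etrans e1 (esym e2))) eqxx.
- rewrite (sg_nf_mul H3); split=> [ec m|all_c].
    have [a0 b0] : sg_nf (eval rho t1) <> NZero H /\ sg_nf (eval rho t2) <> NZero H.
      by apply: nf_mul_neq0; rewrite ec.
    case/allpairsP => -[m1 m2] /= [m1t m2t ->]; rewrite mprod_cat -ec.
    by rewrite ((IH1 _ a0).1 erefl m1 m1t) ((IH2 _ b0).1 erefl m2 m2t).
  have prodE m1 m2 : m1 \in mons t1 -> m2 \in mons t2 ->
      nf_mul (mprod r m1) (mprod r m2) = c.
    by move=> m1t m2t; rewrite -mprod_cat; apply: all_c; apply: allpairs_f.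
  have [m1 m1t] : exists m1, m1 \in mons t1.
    by case: (mons t1) (mons_neq0 t1) => // m1 ? _; exists m1; rewrite mem_head.
  have [m2 m2t] : exists m2, m2 \in mons t2.
    by case: (mons t2) (mons_neq0 t2) => // m2 ? _; exists m2; rewrite mem_head.
  have [a0 b0] : mprod r m1 <> NZero H /\ mprod r m2 <> NZero H.
    by apply: nf_mul_neq0; rewrite prodE.
  have canc a b d : a != [::] -> b != [::] -> d != [::] ->
      nf_mul (mprod r a) (mprod r b) = c -> nf_mul (mprod r a) (mprod r d) = c ->
      mprod r b = mprod r d.
    move=> an bn dn eb ed.
    apply: (nf_cancel H3 (x := mprod r a));
      try (by apply: mprod_reached); try (by apply: mprod_neq1).
      by rewrite ed.
    by rewrite eb.
  have -> : sg_nf (eval rho t1) = mprod r m1.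
    apply/(IH1 _ a0) => m mt; apply: (canc m2); rewrite ?(mem_mons_neq0 m2t) //;
      rewrite ?(mem_mons_neq0 m1t) ?(mem_mons_neq0 mt) // nf_mulC prodE //.
  have -> : sg_nf (eval rho t2) = mprod r m2.
    apply/(IH2 _ b0) => m mt; apply: (canc m1); rewrite ?(mem_mons_neq0 m2t) //;
      rewrite ?(mem_mons_neq0 m1t) ?(mem_mons_neq0 mt) // prodE //.
  exact: prodE.
Qed.

End Monomials.

(** * Three colours and a 3-element hyperedge indexed by them *)

Notation color := (option bool).

(** Two colours [Some _] give [None] even when they are equal; this fixes the colour of arc vertices
    also where the bipartition used later is not proper. *)
Definition third_color (a b : color) : color :=
  match a, b with
  | Some _, Some _ | None, None => None
  | Some c, None | None, Some c => Some (~~ c)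
  end.

Lemma third_colorP a b : a != b -> uniq [:: a; b; third_color a b].
Proof. by case: a b => [[]|] [[]|]. Qed.

Section Triangle.
Variable H : hypergraph.
Hypothesis H3 : is_hypergraph3 H.
Local Notation V := (vertex H).
Local Notation E := (hyperedges H).

Lemma ex_triangle : exists f : color -> V, injective f /\
  forall a b c, uniq [:: a; b; c] -> [set f a; f b; f c] \in E.
Proof.
have [e eE e3] := ex_edge3 H3.
have c3 : #|{: color}| = #|e| by rewrite e3 card_option card_bool.
pose f (i : color) : V := enum_val (cast_ord c3 (enum_rank i)).
have finj : injective f by move=> i j /enum_val_inj/cast_ord_inj/enum_rank_inj.
exists f; split=> // a b c abc; suff -> : [set f a; f b; f c] = e by [].
apply/eqP; rewrite eqEcard e3 !subUset !sub1set !enum_valP /=.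
have := abc; rewrite -(map_inj_uniq finj) => /card_uniqP /= <-.
by apply/subset_leq_card/subsetP => x; rewrite !inE orbA.
Qed.

Variable f : color -> V.
Hypothesis finj : injective f.
Hypothesis fE : forall a b c, uniq [:: a; b; c] -> [set f a; f b; f c] \in E.

Lemma triangle_card a b c : uniq [:: a; b; c] -> #|[set f a; f b; f c]| = 3.
Proof.
rewrite -(map_inj_uniq finj) => /card_uniqP /= <-.
by apply: eq_card => x; rewrite !inE orbA.
Qed.

Lemma triangle_pair_reached a : nf_reached (NPair (f a)).
Proof.
have [b ab] : exists b : color, a != b.
  have: 0 < #|~: [set a]| by rewrite cardsCs setCK cards1 card_option card_bool.
  by rewrite card_gt0 => /set0Pn[b]; rewrite !inE eq_sym; exists b.
have abc := third_colorP ab; set c := third_color a b in abc.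
exists (f b), (f c); have := fE abc; have := abc.
rewrite -(map_inj_uniq finj) /= !inE !negb_or -setUA.
by case/andP => /andP[-> ->] /andP[-> _] ->.
Qed.

(** A 2-element hyperedge is disjoint from all others, so it cannot lie inside the 3-element one. *)
Lemma triangle_mul2 a b : nf_mul (NGen (f a)) (NGen (f b)) <> NTop H.
Proof.
case: nf_pairP => // ab abE.
have abc : uniq [:: a; b; third_color a b].
  by apply: third_colorP; apply: contra_neq ab => ->.
have c2 : #|[set f a; f b]| = 2 by rewrite cards2 ab.
have fab : f a \in [set f a; f b; f (third_color a b)] by rewrite !inE eqxx.
have := edge2_disjoint H3 abE (fE abc) c2 (set21 _ _) fab.
by move=> e; have := triangle_card abc; rewrite e c2.
Qed.

Lemma triangle_mul3 a b c :
  nf_mul (NGen (f a)) (nf_mul (NGen (f b)) (NGen (f c))) =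
  if uniq [:: a; b; c] then NTop H else NZero H.
Proof.
rewrite (nf_mulA H3) (nf_tripleE H3) -[in RHS](map_inj_uniq finj).
case: (boolP (uniq [seq f i | i <- [:: a; b; c]])) => // u.
by have := u; rewrite (map_inj_uniq finj) => /fE ->.
Qed.

End Triangle.

(** * Transfer of identities in few variables from S_H to S_G *)

Section Transfer.
Variable G : hypergraph.
Hypothesis G3 : is_hypergraph3 G.
Hypothesis edges3 : forall e, e \in hyperedges G -> #|e| = 3.
Local Notation V := (vertex G).
Local Notation E := (hyperedges G).

Definition rainbow_on (W : {set V}) (k : V -> color) : Prop :=
  forall u v w, u \in W -> v \in W -> w \in W ->
    uniq [:: u; v; w] -> [set u; v; w] \in E -> uniq [:: k u; k v; k w].

(* Colours are sent to the vertices of one 3-element hyperedge of H; the last two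
   clauses keep the products a_u P_v (u <> v) and a_u a_v a_w, {u, v, w} not a
   hyperedge, from becoming the top element there. *)
Definition separated (n : nat) : Prop :=
  forall W : {set V}, #|W| <= n ->
  [/\ exists k, rainbow_on W k,
      forall u v, u \in W -> v \in W -> u != v ->
        exists2 k, rainbow_on W k & k u != k v &
      forall u v w, u \in W -> v \in W -> w \in W ->
        ~~ (uniq [:: u; v; w] && ([set u; v; w] \in E)) ->
        exists2 k, rainbow_on W k & ~~ uniq [:: k u; k v; k w]].

Variable H : hypergraph.
Hypothesis H3 : is_hypergraph3 H.

(** A rainbow colouring of the vertices used by the variables of [s] turns [rho] into an assignment
    in S_H that keeps every monomial of [s] at the top, so every monomial of [t] becomes top there.
    If one were not top in S_G, a suitable separating colouring would prevent this. *)
Lemma top_transfer n (s t : term) (rho : nat -> flat_algebra G) :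
  separated n -> satisfies (flat_algebra H) (s, t) ->
  size (term_vars s) <= n ->
  sg_nf (eval rho s) = NTop G -> sg_nf (eval rho t) = NTop G.
Proof.
move=> sep st sn /(sg_nf_evalP G3) stop.
have {}stop : forall m, m \in mons s -> mprod (fun i => sg_nf (rho i)) m = NTop G.
  exact: stop.
apply/(sg_nf_evalP G3) => // m mt.
set r := fun i => sg_nf (rho i) in stop *.
have r1 i : r i <> NOne G by exact: sg_nf_neq1.
have [f [finj fE]] := ex_triangle H3.
pose base (x : normal_form G) : option V :=
  match x with NGen u | NPair u => Some u | _ => None end.
(* Each variable of [s] contributes at most one vertex, which bounds [W] by [n]. *)
pose W := [set u | Some u \in [seq base (r i) | i <- term_vars s]].
have Wn : #|W| <= n.
  rewrite cardE -(size_map Some).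
  apply: leq_trans sn; rewrite -(size_map (fun i => base (r i))).
  apply: uniq_leq_size; first by rewrite map_inj_uniq ?enum_uniq // => ? ? [].
  by move=> _ /mapP[u + ->]; rewrite mem_enum inE.
have memW i u : i \in term_vars s -> base (r i) = Some u -> u \in W.
  by move=> iX bu; rewrite inE; apply/mapP; exists i.
pose phi k (x : normal_form G) : normal_form H :=
  match x with
  | NGen u => NGen (f (k u)) | NPair u => NPair (f (k u))
  | NTop => NTop H | _ => NZero H end.
(* Variables outside [s] go to zero, so no monomial of [t] that becomes top can contain one. *)
pose r' k i := if i \in term_vars s then phi k (r i) else NZero H.
have r'1 k i : r' k i <> NOne H by rewrite /r'; case: ifP => // _; case: (r i).
have no2 u v : nf_mul (NGen u) (NGen v) <> NTop G.
  by case: nf_pairP => // uv /edges3; rewrite cards2 uv.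
have image k : rainbow_on W k -> mprod (r' k) m = NTop H.
  move=> kW.
  have [rho' rho'E] : exists rho' : nat -> flat_algebra H,
      forall i, sg_nf (rho' i) = r' k i.
    have ex i : exists a : flat_algebra H, sg_nf a = r' k i.
      apply: (ex_sg_nf H3) => //; rewrite /r'; case: ifP => // _.
      by case: (r i) => // u; apply: (triangle_pair_reached finj fE).
    by exists (fun i => projT1 (cid (ex i))) => i; case: cid.
  have rhoE : (fun i => sg_nf (rho' i)) = r' k.
    by apply: functional_extensionality_dep.
  suff /(sg_nf_evalP H3) : sg_nf (eval rho' t) = NTop H.
    by rewrite rhoE; apply.
  rewrite -(st rho'); apply/(sg_nf_evalP H3) => // m' m's; rewrite rhoE.
  have m'X i : i \in m' -> i \in term_vars s by apply: mem_term_vars.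
  case: (mprod_topP G3 r1 (stop _ m's)) m'X
    => [i ri|i j rij|i j l u v w ri rj rl uvw uvwE] m'X.
  - by rewrite /= nf_mul1 /r' m'X ?mem_head // ri.
  - rewrite /= nf_mul1 /r' !m'X ?inE ?eqxx ?orbT //.
    case: (r i) (r j) (r1 i) (r1 j) rij => [|||u|u] [|||v|v] // _ _ rij;
      try by case: (no2 u v).
      by move: rij => /=; have [->|//] := eqVneq u v; rewrite eqxx.
    by move: rij => /=; have [->|//] := eqVneq u v; rewrite eqxx.
  - rewrite /= nf_mul1 /r' !m'X ?inE ?eqxx ?orbT // ri rj rl.
    rewrite -[LHS]/(nf_mul (NGen _) (nf_mul (NGen _) (NGen _))).
    rewrite (triangle_mul3 H3 finj fE) kW //.
    + by apply: (memW i); rewrite ?m'X ?inE ?eqxx ?orbT // ri.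
    + by apply: (memW j); rewrite ?m'X ?inE ?eqxx ?orbT // rj.
    + by apply: (memW l); rewrite ?m'X ?inE ?eqxx ?orbT // rl.
have [[k0 k0W] sep2 sep3] := sep W Wn.
have mX i : i \in m -> i \in term_vars s.
  move=> im; apply/negPn/negP => iX; have := image _ k0W.
  by rewrite (mprod_mem0 im) // /r' (negPf iX).
have top0 := image _ k0W.
case: (mprod_topP H3 (r'1 k0) top0) mX image
  => [i ri|i j rij|i j l u v w ri rj rl uvw uvwE] mX image.
- rewrite /= nf_mul1; move: ri; rewrite /r' mX ?mem_head //.
  by case: (r i).
(* The images of two generators never multiply to the top, so one factor is a generator at [u] and
   the other a pair at [v], or conversely; a colouring separating [u] from [v] rules out
   [u != v]. *)
- have iX : i \in term_vars s by rewrite mX ?inE ?eqxx ?orbT.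
  have jX : j \in term_vars s by rewrite mX ?inE ?eqxx ?orbT.
  have {}image k : rainbow_on W k -> nf_mul (phi k (r i)) (phi k (r j)) = NTop H.
    by move=> /image; rewrite /= nf_mul1 /r' iX jX.
  have := memW j ^~ jX; have := memW i ^~ iX.
  rewrite /= nf_mul1; move: image (r1 i) (r1 j).
  case: (r i) (r j) => [|||u|u] [|||v|v] image // _ _ uW vW;
    try by have := image _ k0W.
  + by case: (triangle_mul2 H3 finj fE (image _ k0W)).
  + have [->|uv] := eqVneq u v; first by rewrite /= eqxx.
    have [k kW] := sep2 u v (uW _ erefl) (vW _ erefl) uv.
    have /= := image _ kW; have [/finj->|//] := eqVneq (f (k u)) (f (k v)).
    by rewrite eqxx.
  + have [->|uv] := eqVneq u v; first by rewrite /= eqxx.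
    have [k kW] := sep2 u v (uW _ erefl) (vW _ erefl) uv.
    have /= := image _ kW; have [/finj->|//] := eqVneq (f (k u)) (f (k v)).
    by rewrite eqxx.
- have iX : i \in term_vars s by rewrite mX ?inE ?eqxx ?orbT.
  have jX : j \in term_vars s by rewrite mX ?inE ?eqxx ?orbT.
  have lX : l \in term_vars s by rewrite mX ?inE ?eqxx ?orbT.
  move: ri rj rl image; rewrite /r' /= iX jX lX !nf_mul1.
  have := memW l ^~ lX; have := memW j ^~ jX; have := memW i ^~ iX.
  case: (r i) => //= u' u'W; case: (r j) => //= v' v'W.
  case: (r l) => //= w' w'W _ _ _ image.
  rewrite -[LHS]/(nf_mul (NGen u') (nf_mul (NGen v') (NGen w'))).
  rewrite (nf_mulA G3) (nf_tripleE G3); case: ifPn => // nE.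
  (* Were the triple not a hyperedge, this colouring would send its product to zero in S_H. *)
  have [k kW kn] := sep3 _ _ _ (u'W _ erefl) (v'W _ erefl) (w'W _ erefl) nE.
  have := image _ kW.
  rewrite -[LHS]/(nf_mul (NGen _) (nf_mul (NGen _) (NGen _))).
  by rewrite (triangle_mul3 H3 finj fE) (negPf kn).
Qed.

End Transfer.

Fixpoint term_bound (t : term) : nat :=
  match t with
  | Var n => n.+1
  | Add t1 t2 | Mul t1 t2 => maxn (term_bound t1) (term_bound t2)
  end.

Lemma eval_ext (A : algebra) (rho rho' : nat -> A) t :
  (forall i, i < term_bound t -> rho i = rho' i) -> eval rho t = eval rho' t.
Proof.
elim: t => [n|t1 IH1 t2 IH2|t1 IH1 t2 IH2] /= eq; first exact: eq.
  by rewrite IH1 ?IH2 // => i it; apply: eq; rewrite leq_max it ?orbT.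
by rewrite IH1 ?IH2 // => i it; apply: eq; rewrite leq_max it ?orbT.
Qed.

Lemma size_term_vars_mul_var s z :
  size (term_vars (Mul s (Var z))) <= (size (term_vars s)).+1.
Proof.
apply: (@uniq_leq_size _ _ (z :: term_vars s)); first exact: undup_uniq.
move=> i; rewrite mem_undup => /flattenP[m /allpairsP[[m1 m2] /= [m1s]]].
rewrite inE => /eqP -> -> ; rewrite mem_cat inE in_cons orbC.
by case/orP => [->//|im1]; rewrite (mem_term_vars m1s im1) orbT.
Qed.

Section TransferIdentity.
Variables G H : hypergraph.
Hypothesis G3 : is_hypergraph3 G.
Hypothesis edges3 : forall e, e \in hyperedges G -> #|e| = 3.
Hypothesis H3 : is_hypergraph3 H.

(* Multiplying both sides by a fresh variable sent to a codivisor of the value of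
   s reduces to the case where that value is the top element. *)
Lemma nonzero_transfer n (s t : term) (rho : nat -> flat_algebra G) :
  separated G n -> satisfies (flat_algebra H) (s, t) ->
  size (term_vars s) < n -> eval rho s <> sg_zero G ->
  eval rho s = eval rho t.
Proof.
move=> sep st sn s0.
have [stop|sntop] := pselect (sg_nf (eval rho s) = NTop G).
  apply: (sg_nf_inj G3); rewrite stop; apply/esym.
  exact: (top_transfer G3 edges3 H3 sep st (ltnW sn) stop).
have [b sb] := sg_codivisor G3 s0 sntop.
pose z := maxn (term_bound s) (term_bound t).
pose rho' : nat -> flat_algebra G := fun i => if i == z then b else rho i.
have szE : eval rho' s = eval rho s.
  apply: eval_ext => i it; rewrite /rho' ltn_eqF //.
  by apply: leq_trans it _; rewrite leq_maxl.
have tzE : eval rho' t = eval rho t.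
  apply: eval_ext => i it; rewrite /rho' ltn_eqF //.
  by apply: leq_trans it _; rewrite leq_maxr.
have bE : rho' z = b by rewrite /rho' eqxx.
have stz : satisfies (flat_algebra H) (Mul s (Var z), Mul t (Var z)).
  by move=> r; have /= := st r => ->.
have tb : sg_nf (sg_mul (eval rho t) b) = NTop G.
  have top : sg_nf (eval rho' (Mul t (Var z))) = NTop G.
    apply: (top_transfer G3 edges3 H3 sep stz).
      exact: leq_trans (size_term_vars_mul_var s z) sn.
    by rewrite /= szE bE.
  by rewrite -[RHS]top /= tzE bE.
apply: (sg_zero_cancel G3 (x := b)).
  by rewrite !(sg_mulC G3 b); apply: (sg_nf_inj G3); rewrite sb.
rewrite (sg_mulC G3) => e; have := sg_nf_zero G3.
by rewrite -e sb.
Qed.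

Lemma identity_transfer n (s t : term) :
  separated G n -> satisfies (flat_algebra H) (s, t) ->
  size (term_vars s) < n -> size (term_vars t) < n ->
  satisfies (flat_algebra G) (s, t).
Proof.
move=> sep st sn tn rho /=.
have [s0|s0] := pselect (eval rho s = sg_zero G); last first.
  exact: (nonzero_transfer sep st sn s0).
have [t0|t0] := pselect (eval rho t = sg_zero G); first by rewrite s0 t0.
have ts : satisfies (flat_algebra H) (t, s) by move=> r; apply/esym/st.
exact: esym (nonzero_transfer sep ts tn t0).
Qed.

End TransferIdentity.

(** * The 3-hypergraph of a digraph and its separating colourings *)

Section ArcHypergraph.
Variables (X Y : finType) (src tgt : Y -> X).
Hypothesis loopless : forall y, src y != tgt y.
Hypothesis simple : forall y y',
  [set src y; tgt y] = [set src y'; tgt y'] -> y = y'.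
Hypothesis covering : forall x, exists y, x \in [set src y; tgt y].
Variable y0 : Y.

Definition arc_edge (y : Y) : {set X + Y} :=
  [set inl (src y); inl (tgt y); inr y].

Definition arc_hypergraph : hypergraph :=
  @Hypergraph (X + Y)%type [set arc_edge y | y : Y].

Lemma mem_arc_edgel y x :
  (inl x \in arc_edge y) = (x \in [set src y; tgt y]).
Proof. by rewrite !in_setU !in_set1 orbF. Qed.

Lemma mem_arc_edger y y' : (inr y' \in arc_edge y) = (y' == y).
Proof. by rewrite !in_setU !in_set1. Qed.

Definition mem_arc_edge := (mem_arc_edgel, mem_arc_edger).

Lemma card_arc_edge y : #|arc_edge y| = 3.
Proof.
have : uniq [:: inl (src y); inl (tgt y); inr y : X + Y].
  by rewrite /= !in_cons !in_nil !orbF andbT; apply: loopless.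
move/card_uniqP => /= <-.
by apply: eq_card => x; rewrite !in_setU !in_set1 !in_cons in_nil orbF orbA.
Qed.

(** Linearity holds because [inr y] lies on the hyperedge of [y] only, and two distinct vertices of
    [X] lie together on at most one hyperedge by [simple]. *)
Lemma arc_hypergraph3P : is_hypergraph3 arc_hypergraph.
Proof.
have eq2 (x x' : X) y : x != x' -> x \in [set src y; tgt y] ->
    x' \in [set src y; tgt y] -> [set x; x'] = [set src y; tgt y].
  move=> xx' xy x'y; apply/eqP.
  by rewrite eqEcard subUset !sub1set xy x'y !cards2 xx' loopless.
split.
- apply/eqP; rewrite eqn_leq; apply/andP; split.
    by apply/bigmax_leqP => e /imsetP[y _ ->]; rewrite card_arc_edge.
  by apply: (bigmax_sup (arc_edge y0)); rewrite ?imset_f // card_arc_edge.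
- move=> e e' /imsetP[y _ ->] /imsetP[y' _ ->] yy'.
  rewrite leqNgt; apply/negP => /card_gt1P[u [v []]].
  rewrite !in_setI => /andP[uy uy'] /andP[vy vy'] uv.
  case/eqP: yy'; congr arc_edge; move: uy uy' vy vy' uv.
  case: u v => [x|b] [x'|b']; rewrite !mem_arc_edge;
    try by move=> /eqP -> /eqP.
    move=> xy xy' x'y x'y' xx'; apply: simple.
    by rewrite -(@eq2 x x' y) // (@eq2 x x' y').
  by move=> _ _ /eqP -> /eqP.
- apply/setP => -[x|y]; rewrite in_setT; apply/bigcupP.
    have [y xy] := covering x; exists (arc_edge y); first exact: imset_f.
    by rewrite mem_arc_edge.
  by exists (arc_edge y); [exact: imset_f|rewrite mem_arc_edge].
- by move=> e /imsetP[y _ ->]; rewrite card_arc_edge.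
- by move=> e f /imsetP[y _ ->] _; rewrite card_arc_edge.
Qed.

(* The vertex q, if any, is recoloured with the third colour None, which the
   two classes of the bipartition do not use. *)
Definition recolor (beta : X -> bool) (q : option X) (x : X) : color :=
  if Some x == q then None else Some (beta x).

Definition extend_color (k : X -> color) (v : X + Y) : color :=
  match v with
  | inl x => k x
  | inr y => third_color (k (src y)) (k (tgt y))
  end.

(** A hyperedge inside [W] comes from an arc with endpoints in [W'], which [beta] colours
    differently. Recolouring one vertex with [None] keeps them different, and the arc vertex takes
    the remaining colour. *)
Lemma recolor_rainbow (W : {set X + Y}) (W' : {set X}) beta q :
  (forall y, inr y \in W -> src y \in W' /\ tgt y \in W') ->
  (forall y, src y \in W' -> tgt y \in W' -> beta (src y) != beta (tgt y)) ->
  @rainbow_on arc_hypergraph W (extend_color (recolor beta q)).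
Proof.
move=> WW' bip u v w uW vW wW uvw /imsetP[y _ yE].
have mem z : (z \in [:: u; v; w]) = (z \in arc_edge y).
  by rewrite -yE !in_setU !in_set1 !in_cons in_nil orbF orbA.
have yW : inr y \in W.
  have : inr y \in [:: u; v; w] by rewrite mem mem_arc_edge.
  by rewrite !in_cons in_nil orbF => /or3P[]/eqP ->.
have [sW tW] := WW' y yW; have byy := bip y sW tW; have st := loopless y.
have kst : recolor beta q (src y) != recolor beta q (tgt y).
  rewrite /recolor; have [<-|_] := eqVneq (Some (src y)) q.
    by rewrite (inj_eq (@Some_inj _)) [tgt y == _]eq_sym (negPf st).
  by case: ifP => // _; apply: contra_neq byy => -[].
set k := extend_color _.
have kinj : {in [:: u; v; w] &, injective k}.
  have third := third_colorP kst.
  have := third; rewrite /= !in_cons !in_nil !orbF andbT negb_or.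
  case/andP => /andP[_ k1] k2.
  have mem3 z : z \in arc_edge y ->
      [\/ z = inl (src y), z = inl (tgt y) | z = inr y].
    rewrite !in_setU !in_set1 -orbA => /or3P[]/eqP; by constructor.
  move=> a b; rewrite !mem => /mem3 + /mem3.
  case=> ->; case=> -> //= /eqP; rewrite ?(negPf kst) ?(negPf k1) ?(negPf k2) //;
    by rewrite eq_sym ?(negPf kst) ?(negPf k1) ?(negPf k2).
by rewrite -[[:: k u; k v; k w]]/(map k [:: u; v; w]) (map_inj_in_uniq kinj).
Qed.

Lemma arc_endpoint_notin y (x x' : X) : [set x; x'] != [set src y; tgt y] ->
  exists2 q, q \in [set src y; tgt y] & q \notin [set x; x'].
Proof.
move=> ne; apply/exists_inP; apply: contraR ne.
rewrite negb_exists_in => /forall_inP sub; rewrite eq_sym eqEcard; apply/andP; split.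
  by apply/subsetP => q /sub; rewrite negbK.
by rewrite !cards2 loopless; case: (_ != _).
Qed.

Lemma extend_recolor_endpoint beta q y : q \in [set src y; tgt y] ->
  isSome (extend_color (recolor beta (Some q)) (inr y)).
Proof.
have st := loopless y.
rewrite /= /recolor; case/set2P => ->; rewrite eqxx (inj_eq (@Some_inj _)).
  by rewrite [tgt y == _]eq_sym (negPf st).
by rewrite (negPf st).
Qed.

Lemma recolor_some beta q x : Some x != q -> isSome (recolor beta q x).
Proof. by rewrite /recolor => /negPf ->. Qed.

Lemma some_not_uniq (a b c : color) :
  isSome a -> isSome b -> isSome c -> ~~ uniq [:: a; b; c].
Proof. by case: a b c => [[]|] [[]|] [[]|]. Qed.

(** By the number of arc vertices in the triple. Without recolouring, three vertices of [X] share
    two colours, and any two arc vertices both get [None]. For a single arc vertex [y], some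
    endpoint of [y] is outside the triple; recolouring it leaves only colours [Some _] on the
    triple. *)
Lemma not_edge_some beta u v w : uniq [:: u; v; w] ->
  [set u; v; w] \notin hyperedges arc_hypergraph ->
  exists q, ~~ uniq (map (extend_color (recolor beta q)) [:: u; v; w]).
Proof.
have mixed x x' y (u' v' w' : X + Y) : x != x' ->
    [set inl x; inl x'; inr y] = [set u'; v'; w'] ->
    [set u'; v'; w'] \notin hyperedges arc_hypergraph ->
    exists q, [/\ isSome (recolor beta q x), isSome (recolor beta q x') &
      isSome (extend_color (recolor beta q) (inr y))].
  move=> xx' <- nE.
  have [|q qy qx] := @arc_endpoint_notin y x x'.
    apply: contra nE => /eqP e; apply/imsetP; exists y => //.
    apply/setP => -[a|b]; rewrite mem_arc_edge -?e !in_setU !in_set1 //.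
    exact: orbF.
  exists (Some q); split; last exact: extend_recolor_endpoint.
    by apply: recolor_some; apply: contraNneq qx => -[->]; rewrite set21.
  by apply: recolor_some; apply: contraNneq qx => -[->]; rewrite set22.
case: u v w => [x|y] [x'|y'] [x''|y''].
- by move=> _ _; exists None; apply: some_not_uniq.
- rewrite /= !in_cons !in_nil => /andP[xx' _] nE.
  have [|q [a b c]] := mixed x x' y'' _ _ _ _ erefl nE.
    by case/norP: xx'.
  by exists q; apply: some_not_uniq.
- rewrite /= !in_cons !in_nil => /andP[xx' _] nE.
  have [||q [a b c]] := mixed x x'' y' _ _ _ _ _ nE.
  + by case/norP: xx' => _; rewrite orbF.
  + by rewrite setUAC.
  + by exists q; apply: some_not_uniq.
- by move=> _ _; exists None; rewrite /= ?andbF.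
- rewrite /= !in_cons !in_nil => /andP[xx' _] nE.
  have [||q [a b c]] := mixed x' x'' y _ _ _ _ _ nE.
  + by move: xx'; rewrite orbF.
  + by rewrite setUC setUA.
  + by exists q; apply: some_not_uniq.
- by move=> _ _; exists None; rewrite /= ?andbF.
- by move=> _ _; exists None; rewrite /= ?andbF.
- by move=> _ _; exists None; rewrite /= ?andbF.
Qed.

(** Two vertices of [X] differ once one of them is recoloured; a vertex of [X] and an arc vertex
    differ without recolouring. For two arcs, recolouring an endpoint of one that is not on the
    other gives [Some _] against [None]. *)
Lemma separate_pair beta u v : u != v ->
  exists q, extend_color (recolor beta q) u != extend_color (recolor beta q) v.
Proof.
case: u v => [x|y] [x'|y'] uv.
- have xx' : x != x' by apply: contra_neq uv => ->.
  exists (Some x); rewrite /= /recolor eqxx (inj_eq (@Some_inj _)).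
  by rewrite [_ == x]eq_sym (negPf xx').
- by exists None.
- by exists None.
- have [|q qy qy'] := @arc_endpoint_notin y (src y') (tgt y').
    by apply: contraNneq uv => /esym/simple ->.
  exists (Some q); have := extend_recolor_endpoint beta qy.
  suff -> : extend_color (recolor beta (Some q)) (inr y') = None.
    by case: (extend_color _ _).
  move: qy'; rewrite in_set2 negb_or /= /recolor => /andP[q1 q2].
  rewrite !(inj_eq (@Some_inj _)) [src y' == q]eq_sym (negPf q1).
  by rewrite [tgt y' == q]eq_sym (negPf q2).
Qed.

Definition small_bipartite (n : nat) : Prop :=
  forall W : {set X}, #|W| <= n -> exists beta : X -> bool,
    forall y, src y \in W -> tgt y \in W -> beta (src y) != beta (tgt y).

Lemma arc_hypergraph_separated n :
  small_bipartite n.*2 -> @separated arc_hypergraph n.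
Proof.
move=> bip W Wn.
pose f1 (v : X + Y) := match v with inl x => x | inr y => src y end.
pose f2 (v : X + Y) := match v with inl x => x | inr y => tgt y end.
(* An arc vertex contributes both its endpoints, whence the doubled bound. *)
pose W' := f1 @: W :|: f2 @: W.
have W'n : #|W'| <= n.*2.
  rewrite -addnn; apply: leq_trans (leq_card_setU _ _) _.
  by apply: leq_add; apply: leq_trans (leq_imset_card _ _) Wn.
have [beta betaP] := bip W' W'n.
have WW' y : inr y \in W -> src y \in W' /\ tgt y \in W'.
  by move=> yW; rewrite !in_setU; split; apply/orP; [left|right];
    apply/imsetP; exists (inr y).
have rain q := recolor_rainbow q WW' betaP.
split; first by exists (extend_color (recolor beta None)).
  move=> u v _ _ /(separate_pair beta)[q quv].
  by exists (extend_color (recolor beta q)).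
move=> u v w _ _ _ nE.
have [uvw|nuvw] := boolP (uniq [:: u; v; w]).
  rewrite uvw in nE; have [q nq] := not_edge_some beta uvw nE.
  by exists (extend_color (recolor beta q)).
exists (extend_color (recolor beta None)) => //.
by apply: contra nuvw => /(map_uniq (f := extend_color _) (s := [:: u; v; w])).
Qed.

End ArcHypergraph.

(** * The shift digraph on words without repeated letters: small subgraphs and colourings *)

Section ShiftGraph.
Variable N : nat.

Definition inj_word (k : nat) : Type := {x : k.-tuple 'I_N | uniq x}.
HB.instance Definition _ k := Finite.on (inj_word k).

Definition letters k (x : inj_word k) : seq 'I_N := val (val x).

Lemma letters_inj k : injective (@letters k).
Proof. by move=> x y /val_inj/val_inj. Qed.

Lemma size_letters k (x : inj_word k) : size (letters x) = k.
Proof. exact: size_tuple. Qed.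

Lemma uniq_letters k (x : inj_word k) : uniq (letters x).
Proof. exact: (valP x). Qed.

Lemma ex_inj_word k s : size s = k -> uniq s ->
  exists x : inj_word k, letters x = s.
Proof.
move=> sk us; have sk' : size s == k by rewrite sk.
by exists (Sub (Tuple sk') us).
Qed.

Variable k : nat.
Local Notation X := (inj_word k).
Local Notation Y := (inj_word k.+1).

Lemma init_size (y : Y) : size (take k (letters y)) == k.
Proof. by rewrite size_takel // size_letters. Qed.

Lemma tail_size (y : Y) : size (behead (letters y)) == k.
Proof. by rewrite size_behead size_letters. Qed.

Definition init (y : Y) : X :=
  Sub (Tuple (init_size y)) (take_uniq k (uniq_letters y)).

Lemma tail_uniq (y : Y) : uniq (behead (letters y)).
Proof. by rewrite -drop1 drop_uniq // uniq_letters. Qed.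

Definition tail (y : Y) : X := Sub (Tuple (tail_size y)) (tail_uniq y).

Lemma letters_init y : letters (init y) = take k (letters y).
Proof. by []. Qed.

Lemma letters_tail y : letters (tail y) = behead (letters y).
Proof. by []. Qed.

Lemma index_init e y : e \in letters (init y) ->
  index e (letters (init y)) = index e (letters y).
Proof.
rewrite letters_init => ey.
by rewrite -[in RHS](cat_take_drop k (letters y)) index_cat ey.
Qed.

Lemma index_tail e y : e \in letters (tail y) ->
  index e (letters y) = (index e (letters (tail y))).+1.
Proof.
rewrite letters_tail; have := uniq_letters y.
case: (letters y) => //= a s /andP[as_ _] es.
by case: eqP => // ae; rewrite ae es in as_.
Qed.

Lemma mem_init e y : e \in letters (tail y) ->
  (index e (letters (tail y))).+1 < k -> e \in letters (init y).
Proof.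
move=> ey; rewrite -index_tail // => ek; rewrite letters_init in_take //.
move: ey; rewrite letters_tail; case: (letters y) => //= a s.
by rewrite inE orbC => ->.
Qed.

Lemma mem_tail e y : e \in letters (init y) ->
  0 < index e (letters (init y)) -> e \in letters (tail y).
Proof.
move=> ey; rewrite index_init // letters_tail; move: ey.
rewrite letters_init => /mem_take; case: (letters y) => //= a s.
by rewrite inE eq_sym; case: eqP.
Qed.

(** Adjacency in the undirected graph underlying the subdigraph induced by [W]. *)
Definition near (W : {set X}) : rel X := fun x x' =>
  [&& x \in W, x' \in W &
    [exists y, (x == init y) && (x' == tail y) ||
               (x == tail y) && (x' == init y)]].

Lemma near_sym W : symmetric (near W).
Proof.
move=> x x'; rewrite /near andbCA; congr (_ && (_ && _)).
by apply: eq_existsb => y; rewrite orbC andbC [X in _ || X]andbC.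
Qed.

Lemma near_index W x x' e : near W x x' -> e \in letters x ->
  0 < index e (letters x) -> (index e (letters x)).+1 < k ->
  e \in letters x' /\
  (index e (letters x') <= (index e (letters x)).+1 <= (index e (letters x')).+2).
Proof.
case/and3P => _ _ /existsP[y /orP[]] /andP[/eqP -> /eqP ->] ex i0 ik.
  have et := mem_tail ex i0; split=> //.
  by rewrite index_init // index_tail // leqnn andbT -addn2 leq_addr.
have ei := mem_init ex ik; split=> //.
by rewrite index_init // index_tail // leqnn !ltnS -addn2 leq_addr.
Qed.

(* A letter of x far from both ends survives along short paths, since each step
   moves it by one position only. *)
Lemma near_path W x p e : path (near W) x p -> e \in letters x ->
  size p <= index e (letters x) -> index e (letters x) + size p < k ->
  e \in letters (last x p).
Proof.
elim: p x => //= x' p IH x /andP[xx' px'] ex pi ip.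
have [||ex' /andP[lo hi]] := near_index xx' ex.
- exact: leq_ltn_trans pi.
- by apply: leq_ltn_trans ip; rewrite addnS ltnS leq_addr.
apply: IH => //; first by rewrite -ltnS -ltnS (leq_trans _ hi).
by apply: leq_ltn_trans ip; rewrite addnS -addSn leq_add2r.
Qed.

(** A repetition-free path within [W] has at most [n] steps, and position [n] in a word of length
    [k > 2n] is far enough from both ends for its letter to survive them. *)
Lemma near_connect n (W : {set X}) x x' (a : 'I_N) : #|W| <= n -> n.*2 < k ->
  connect (near W) x x' -> nth a (letters x) n \in letters x'.
Proof.
move=> Wn nk /connectP[p px ->]; have [p' p'x up' _] := shortenP px.
have nk' : n < k by apply: leq_ltn_trans nk; rewrite -addnn leq_addr.
have p'n : size p' <= n.
  apply: leq_trans Wn; rewrite cardE; apply: uniq_leq_size.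
    by case/andP: up'.
  move=> z; rewrite mem_enum; elim: p' x p'x {px up'} => //= z' p' IH x.
  by case/andP => /and3P[_ z'W _] /IH + /predU1P[->//|].
apply: near_path p'x _ _ _; rewrite ?mem_nth ?size_letters //;
  rewrite index_uniq ?uniq_letters ?size_letters //.
by apply: leq_ltn_trans nk; rewrite -addnn leq_add2l.
Qed.

(** All words of a component contain the letter at position [n] of its root. An arc moves this
    letter by one position, so the parity of its position is a bipartition. *)
Lemma shift_small_bipartite n : n.*2 < k -> small_bipartite init tail n.
Proof.
move=> nk W Wn.
(* Reading letters by position needs a default; over an empty alphabet there are no arcs. *)
have [a|noa] := pickP [pred a : 'I_N | true]; last first.
  exists xpredT => y; have := size_letters y.
  by case: (letters y) => // b; have := noa b.
pose e x := nth a (letters (root (near W) x)) n.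
exists (fun x => odd (index (e x) (letters x))) => y iW tW.
have sym := sym_connect_sym (@near_sym W).
have eE : e (tail y) = e (init y).
  rewrite /e; congr (nth a (letters _) n); apply/esym/(rootP sym)/connect1.
  by rewrite /near iW tW; apply/existsP; exists y; rewrite !eqxx.
have et : e (tail y) \in letters (tail y).
  by apply: near_connect Wn nk _; rewrite sym connect_root.
have ei : e (init y) \in letters (init y).
  by apply: near_connect Wn nk _; rewrite sym connect_root.
by rewrite index_init // -eE index_tail //=; case: (odd _).
Qed.

Hypothesis k1 : 1 < k.

Lemma nth_init a (y : Y) i : i < k ->
  nth a (letters (init y)) i = nth a (letters y) i.
Proof. by move=> ik; rewrite letters_init nth_take. Qed.

Lemma nth_tail a (y : Y) i : nth a (letters (tail y)) i = nth a (letters y) i.+1.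
Proof. by rewrite letters_tail nth_behead. Qed.

Lemma letters_nth_inj a (y : Y) i j : i <= k -> j <= k ->
  nth a (letters y) i = nth a (letters y) j -> i = j.
Proof.
move=> ik jk /eqP; rewrite nth_uniq ?uniq_letters ?size_letters //.
by move/eqP.
Qed.

Lemma ex_letter (y : Y) : exists a : 'I_N, a \in letters y.
Proof.
have := size_letters y; case: (letters y) => // a s _.
by exists a; rewrite mem_head.
Qed.

Lemma init_neq_tail y : init y != tail y.
Proof.
have [a _] := ex_letter y; apply/eqP => e.
have := nth_tail a y 0; rewrite -e nth_init ?(ltnW k1) //.
by move/letters_nth_inj => /(_ isT (ltnW k1)).
Qed.

Lemma shift_simple y y' :
  [set init y; tail y] = [set init y'; tail y'] -> y = y'.
Proof.
have [a _] := ex_letter y; move=> e.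
have k0 := ltnW k1.
have iy : init y \in [set init y'; tail y'] by rewrite -e set21.
have ty : tail y \in [set init y'; tail y'] by rewrite -e set22.
have nity := init_neq_tail y.
case/set2P: iy => iE; case/set2P: ty => tE; try by rewrite iE tE eqxx in nity.
  apply: letters_inj; apply: (@eq_from_nth _ a);
    rewrite !size_letters // => -[_|i ik].
    by rewrite -!nth_init // iE.
  by rewrite -!nth_tail tE.
(* Opposite arcs would make the letters at positions 0 and 2 of [y] equal, while [1 < k] gives [y]
   at least three distinct letters. *)
have : nth a (letters y) 2 = nth a (letters y) 0.
  by rewrite -nth_tail tE nth_init // -nth_tail -iE nth_init.
by move/letters_nth_inj => /(_ k1 isT).
Qed.

(** Since [k < N], some letter is missing from [x] and can be appended to it. *)
Lemma shift_covering (x : X) : k < N -> exists y, x \in [set init y; tail y].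
Proof.
move=> kN.
have : 0 < #|~: [set a in letters x]|.
  rewrite cardsCs setCK subn_gt0 card_ord; apply: leq_ltn_trans kN.
  by rewrite cardsE -[leqRHS](size_letters x) card_size.
rewrite card_gt0 => /set0Pn[a]; rewrite !inE => ax.
have [||y yE] := @ex_inj_word k.+1 (rcons (letters x) a).
- by rewrite size_rcons size_letters.
- by rewrite rcons_uniq ax uniq_letters.
exists y; apply/set2P; left; apply: letters_inj.
by rewrite letters_init yE -cats1 take_size_cat ?size_letters.
Qed.

End ShiftGraph.

(* A colouring c of words induces the colouring of shorter words by the set of
   colours of their one-letter extensions; a monochromatic arc for the latter
   extends to one for c. *)
Lemma shift_monochromatic k (C : finType) : exists N, forall c : seq 'I_N -> C,
  exists s, [/\ pairwise (fun i j : 'I_N => i < j) s, size s = k.+2 &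
    c (take k.+1 s) = c (behead s)].
Proof.
elim: k C => [|k IH] C.
  exists #|C|.+1 => c.
  have /injectivePn[i [j ij cij]] : ~~ injectiveb (fun i => c [:: i]).
    apply/injectiveP => /leq_card; by rewrite card_ord ltnn.
  wlog lij : i j ij cij / i < j => [wl|].
    have := ij; rewrite -(inj_eq val_inj) neq_ltn => /orP[|ji]; first exact: wl.
    by apply: (wl j i) => //; rewrite eq_sym.
  by exists [:: i; j]; rewrite /= lij.
have [N cN] := IH {set C}; exists N => c.
pose c' (s : seq 'I_N) :=
  [set c (rcons s y) | y : 'I_N & all (fun x : 'I_N => x < y) s].
have [s [ps ss cs]] := cN c'.
case/lastP: s => [//|s y] in ps ss cs *.
have ss' : size s = k.+1 by move: ss; rewrite size_rcons => -[].
have : c (rcons s y) \in c' (take k.+1 (rcons s y)).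
  rewrite -cats1 take_size_cat // cats1; apply/imsetP; exists y => //.
  by move: ps; rewrite pairwise_rcons inE => /andP[].
rewrite cs => /imsetP[z]; rewrite inE => sz cz.
exists (rcons (rcons s y) z); split.
- rewrite pairwise_rcons ps andbT.
  case: s ss' ps {ss cs cz} sz => [//|x s] _ /= /andP[xs _] sz.
  rewrite sz andbT; apply: ltn_trans (_ : y < z).
    by move: xs; rewrite all_rcons => /andP[].
  by move: sz; rewrite all_rcons => /andP[].
- by rewrite !size_rcons ss'.
- rewrite -cats1 take_size_cat ?size_rcons ?ss' // cats1 cz.
  by case: s ss' {ps ss cs cz sz}.
Qed.

(** The monochromatic word is increasing, hence free of repetitions and so an arc. Its [k + 1]
    distinct letters also give [k < N]. *)
Lemma shift_not_colourable k (C : finType) : 0 < k -> exists N,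
  k < N /\ forall c : inj_word N k -> C, exists y, c (init y) = c (tail y).
Proof.
case: k => // k _; have [N cN] := shift_monochromatic k (option C).
have mono (c : inj_word N k.+1 -> C) : exists y, c (init y) = c (tail y).
  (* The colouring must be defined on all sequences; those that are not vertices receive [None]. *)
  pose c' s := omap c [pick x | letters x == s].
  have c'E x : c' (letters x) = Some (c x).
    rewrite /c'; case: pickP => [x' /eqP/letters_inj -> //|/(_ x)].
    by rewrite eqxx.
  have [s [ps ss cs]] := cN c'.
  have us : uniq s by apply: pairwise_uniq ps => i; rewrite ltnn.
  have [y yE] := ex_inj_word ss us; exists y; apply: Some_inj.
  by rewrite -!c'E letters_init letters_tail yE.
exists N; split=> //.
have [s [ps ss _]] := cN (fun=> None).
have us : uniq s by apply: pairwise_uniq ps => i; rewrite ltnn.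
have := uniq_leq_size us (fun i _ => mem_enum 'I_N i).
by rewrite ss size_enum_ord.
Qed.

(** * Identities in varieties, and the identity separating S_G from S_H *)

Lemma morph_eval (A B : algebra) (f : A -> B) (rho : nat -> A) t :
  homomorphism f -> f (eval rho t) = eval (fun i => f (rho i)) t.
Proof.
by case=> fD fM; elim: t => //= t1 IH1 t2 IH2; rewrite ?fD ?fM IH1 IH2.
Qed.

(** The easy half of Birkhoff's theorem; it carries an identity of S_H over to the whole variety
    that S_H generates. *)
Lemma satisfies_variety e : variety (fun A => satisfies A e).
Proof.
split=> [A B f fhom finj Be rho|A B f fhom fsurj Ae rho|I A Ae rho].
- by apply: finj; rewrite !morph_eval //; apply: Be.
- pose rho' i := projT1 (cid (fsurj (rho i))).
  have -> : rho = fun i => f (rho' i).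
    by apply: functional_extensionality_dep => i; rewrite /rho'; case: cid.
  by rewrite -!morph_eval // Ae.
- have proj t i : eval rho t i = eval (fun n => rho n i) t.
    by elim: t => //= t1 IH1 t2 IH2; rewrite IH1 IH2.
  by apply: functional_extensionality_dep => i; rewrite !proj; apply: Ae.
Qed.

Section ArcIdentity.
Variables (X Y : finType) (src tgt : Y -> X).
Hypothesis loopless : forall y, src y != tgt y.
Variable y0 : Y.
Local Notation G := (arc_hypergraph src tgt).
Hypothesis G3 : is_hypergraph3 G.

Definition arc_monomial (y : Y) : seq nat :=
  map (@pickle (X + Y)%type) [:: inl (src y); inl (tgt y); inr y].

Definition arc_term (y : Y) : term :=
  Mul (Var (pickle (inl (src y) : X + Y)))
    (Mul (Var (pickle (inl (tgt y) : X + Y))) (Var (pickle (inr y : X + Y)))).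

(** [y0] seeds the fold because there is no empty sum; repeating its monomial does not change the
    set of monomials. *)
Definition arc_sum : term :=
  foldr (fun y t => Add (arc_term y) t) (arc_term y0) (enum Y).

Lemma mem_mons_arc_sum m :
  m \in mons arc_sum <-> exists y, m = arc_monomial y.
Proof.
have -> : mons arc_sum = [seq arc_monomial y | y <- rcons (enum Y) y0].
  by rewrite /arc_sum; elim: (enum Y) => //= y s ->.
split=> [/mapP[y _ ->]|[y ->]]; first by exists y.
by apply: map_f; rewrite mem_rcons inE mem_enum orbT.
Qed.

(** A nonzero value would make every monomial nonzero, so the endpoints of each arc would be sent to
    distinct generators: a proper colouring of the digraph. *)
Lemma arc_sum_zero (H : hypergraph) (rho : nat -> flat_algebra H) :
  is_hypergraph3 H ->
  (forall c : X -> option (vertex H), exists y, c (src y) = c (tgt y)) ->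
  eval rho arc_sum = sg_zero H.
Proof.
move=> H3 nocol; apply: (sg_nf_inj H3); rewrite (sg_nf_zero H3).
have [//|nz] := pselect (sg_nf (eval rho arc_sum) = NZero H).
have all_mons := (sg_nf_evalP H3 rho arc_sum nz).1 erefl.
(* Vertices whose value is not a generator get the additional colour [None]. *)
pose col x := if sg_nf (rho (pickle (inl x : X + Y))) is NGen u
              then Some u else None.
have [y yE] := nocol col; exfalso.
have yM : arc_monomial y \in mons arc_sum by apply/mem_mons_arc_sum; exists y.
have := all_mons _ yM; rewrite /= nf_mul1 (nf_mulA H3) => pE.
have r1 i : sg_nf (rho i) <> NOne H by exact: sg_nf_neq1.
have nz3 := nz; rewrite -pE in nz3.
have [u [v [uE vE uv]]] := nf_mul3_neq0 H3 (r1 _) (r1 _) (r1 _) nz3.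
by case/eqP: uv; move: yE; rewrite /col uE vE => -[].
Qed.

(** Sending each vertex to its own generator turns every monomial into the product over a
    hyperedge. *)
Lemma arc_sum_top : exists rho : nat -> flat_algebra G,
  sg_nf (eval rho arc_sum) = NTop G.
Proof.
have ex (v : X + Y) : exists a : flat_algebra G, sg_nf a = NGen (v : vertex G).
  by apply: (ex_sg_nf G3).
pose rho i : flat_algebra G :=
  if unpickle i is Some v then projT1 (cid (ex v)) else sg_zero G.
have rhoE (v : X + Y) : sg_nf (rho (pickle v)) = NGen (v : vertex G).
  by rewrite /rho pickleK; case: cid.
exists rho; apply/(sg_nf_evalP G3) => // m /mem_mons_arc_sum[y ->].
rewrite /mprod /arc_monomial [map _ _]/= [foldr _ _ _]/= !rhoE nf_mul1.
have yE : arc_edge src tgt y \in hyperedges G by apply: imset_f.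
rewrite (nf_mulA G3) (nf_tripleE G3) yE andbT.
have xx' : inl (src y) != inl (tgt y) :> X + Y by exact: loopless.
by rewrite /= !in_cons !in_nil !orbF andbT xx'.
Qed.

End ArcIdentity.

Lemma term_vars_bound (Sigma : seq identity) : exists n,
  List.Forall (fun e => size (term_vars e.1) < n /\ size (term_vars e.2) < n) Sigma.
Proof.
elim: Sigma => [|[s t] Sigma [n IH]]; first by exists 0.
exists (maxn n (maxn (size (term_vars s)) (size (term_vars t))).+1).
constructor; first by rewrite !leq_max !ltnS !leq_max !leqnn !orbT.
by apply: List.Forall_impl IH => e [s1 s2]; rewrite !leq_max s1 s2.
Qed.

Lemma hypergraph_semiring_nfb (H : hypergraph3) :
  nonfinitely_based (hypergraph_semiring H).
Proof.
case=> Sigma basis; have H3 := hypergraph3P H.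
have [n Sn] := term_vars_bound Sigma.
(* Separation for [n] vertices needs bipartite subgraphs on [2n] words, hence [4n < k]; the further
   unit ensures [1 < k] even for [n = 0]. *)
set k := n.*2.*2.+2.
have [N [kN nocol]] := @shift_not_colourable k (option (vertex H)) isT.
(* A constant colouring already yields an arc, so the digraph is not empty. *)
have [y0 _] := nocol (fun=> None).
have loopless := @init_neq_tail N k isT.
pose G := arc_hypergraph (@init N k) (@tail N k).
have G3 : is_hypergraph3 G.
  apply: arc_hypergraph3P y0 => // [y y'|x]; first exact: shift_simple.
  exact: shift_covering.
have edges3 e : e \in hyperedges G -> #|e| = 3.
  by case/imsetP => y _ ->; apply: card_arc_edge.
have sep : separated G n.
  apply: arc_hypergraph_separated => // [y y'|]; first exact: shift_simple.
  exact: shift_small_bipartite.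
have Hbasis : List.Forall (satisfies (hypergraph_semiring H)) Sigma.
  by apply/basis => K _.
(* Each side of an identity in [Sigma] has fewer than [n] variables, so the identity transfers; S_G
   then lies in the variety of S_H. *)
have Gbasis : List.Forall (satisfies (flat_algebra G)) Sigma.
  elim: Sigma Sn Hbasis {basis} => [|[s t] Sigma IH] Sn Hb; first by constructor.
  have [st Hb'] := (List.Forall_cons_iff _ _ _).1 Hb.
  have [[sn tn] Sn'] := (List.Forall_cons_iff _ _ _).1 Sn.
  constructor; last exact: IH.
  exact: (identity_transfer G3 edges3 H3 sep st sn tn).
pose t := arc_sum (@init N k) (@tail N k) y0.
pose e := (t, Mul t t).
have He : satisfies (hypergraph_semiring H) e.
  by move=> rho /=; rewrite (arc_sum_zero y0 rho H3 nocol) (sg_mul0 H3).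
have Ge : satisfies (flat_algebra G) e.
  exact: ((basis _).2 Gbasis) _ (satisfies_variety e) He.
have [rho top] := arc_sum_top loopless y0 G3.
(* The value of [t] here is the top element, whose square is zero. *)
have := Ge rho => /(congr1 (@sg_nf G)) /=.
by rewrite (sg_nf_mul G3) top.
Qed.

Theorem proposition2p4 (H : hypergraph3) :
  nonfinitely_based (hypergraph_semiring H) /\
  subdirectly_irreducible (hypergraph_semiring H).
Proof.
split; [exact: hypergraph_semiring_nfb|exact: hypergraph_semiring_sdi].
Qed.
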